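(* Let $\mathbf{d}\in\mathcal{D}$ and $T\in\mathbb{N}$. Suppose that $\mathcal{F}=\mathcal{F}(\mathbf{d},T)$ and $\mathcal{G}=\mathcal{G}(\mathbf{d},T)$ are CIFSs. Then the following (1) and (2) hold. (1) If $\mathcal{F}$ is irregular, then $\dim_H(J_{\mathcal{F}})\le\dim_H(J_{\mathcal{G}})$. (2) If $\mathcal{G}$ is irregular, then $\dim_H(J_{\mathcal{F}})\ge\dim_H(J_{\mathcal{G}})$.
   Context: Notation. $\mathbb{N}$ is the set of positive integers, $\mathbb{D}=\{z\in\mathbb{C}:|z|<1\}$, $\mathbb{C}$ is identified with $\mathbb{R}^2$, $e(\theta)=e^{2\pi\sqrt{-1}\,\theta}$. $\dim_H$ is Hausdorff dimension. CIFS. Let $X\subset\mathbb{R}^d$ be compact and connected and $I$ a countable (possibly finite) set with at least two elements. A family $\mathcal{S}=\{s_i:X\to X\}_{i\in I}$ of injective contractions is an IFS if $\sup_{i}\mathrm{Lip}(s_i)<1$. For $\omega=(\omega_1,\dots,\omega_N)\in I^N$ put $s_\omega=s_{\omega_1}\circ\dots\circ s_{\omega_N}$. The limit set is $J_{\mathcal{S}}=\bigcup_{\omega\in I^{\mathbb{N}}}\bigcap_{N\ge1}s_{\omega|_N}(X)$, where $\omega|_N=(\omega_1,\dots,\omega_N)$. An IFS $\mathcal{S}$ is a conformal IFS (CIFS) if: (Open Set Condition) $s_i(\mathrm{Int}\,X)\cap s_j(\mathrm{Int}\,X)=\emptyset$ for $i\ne j$; (Cone Condition) there are $0<\alpha<\pi/2$,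 $l>0$ such that for every $x\in\partial X$ there is $u_x\neq0$ with $\{y:0<|y-x|<l,\ \langle y-x,u_x\rangle>|y-x||u_x|\cos\alpha\}\subset\mathrm{Int}(X)$; (Conformality) there is an open connected $V\supset X$ such that all $s_i$ extend to $C^{1+\varepsilon}$ diffeomorphisms on $V$ that are conformal on $V$; (Bounded Distortion) there is $K\ge1$ with $|s_\omega'(y)|\le K|s_\omega'(x)|$ for all $\omega\in\bigcup_N I^N$, $x,y\in V$, where $|s'_\omega(x)|$ is the operator norm of the derivative. Pressure and regularity. For a CIFS, $P_{\mathcal{S}}(t)=\lim_{N\to\infty}\frac1N\log\sum_{\omega\in I^N}\sup_{x\in X}|s_\omega'(x)|^t\in\mathbb{R}\cup\{\infty\}$ for $t\ge0$. $\mathcal{S}$ is regular if $P_{\mathcal{S}}(t)=0$ for some $t\ge0$, and irregular if it is not regular. The systems. $\mathcal{D}$ is the set of real sequences $\{d_n\}_{n\ge1}$ with $d_1\ge2$ and $d_{n+1}-d_n\ge2$ for all $n$. For $\alpha\in\mathbb{C}$, $|\alpha|\ge2$, define $f_\alpha,g_\alpha:\overline{\mathbb{D}}\to\overline{\mathbb{D}}$ by $f_\alpha(z)=\frac{z+\overline{\alpha}}{|\alpha|^2-1}$, $g_\alpha(z)=\frac1{z+\alpha}$. For $\mathbf{d}=\{d_n\}\in\mathcal{D}$, $T\in\mathbb{N}$: $\mathcal{F}(\mathbf{d},T)=\{f_{e(j/T)d_n}:n\in\mathbb{N},\,j=0,\dots,T-1\}$ and $\mathcal{G}(\mathbf{d},T)=\{g_{e(j/T)d_n}:n\in\mathbb{N},\,j=0,\dots,T-1\}$,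 families of maps on $X=\overline{\mathbb{D}}$. *)

(* Defs.v *)
From HB Require Import structures.
From mathcomp Require Import all_boot all_order all_algebra.
From mathcomp Require Import all_classical all_reals all_analysis.
From mathcomp.real_closed Require Import complex.

Set Implicit Arguments.
Unset Strict Implicit.
Unset Printing Implicit Defensive.

Import Order.TTheory GRing.Theory Num.Theory.
Import numFieldNormedType.Exports.

Local Open Scope classical_set_scope.
Local Open Scope ring_scope.

(* R^d is 'rV[R]_d.  The library norm on it is the sup norm, which induces the
   Euclidean topology and the same notion of differential, but metric notions
   (diameter, Lipschitz constant, operator norm) use [enorm]. *)
Definition dotp (R : realType) (d : nat) (u v : 'rV[R]_d) : R :=
  \sum_(k < d) u 0 k * v 0 k.

Definition enorm (R : realType) (d : nat) (u : 'rV[R]_d) : R :=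
  Num.sqrt (dotp u u).

(* [L] is meant to be linear, so that the supremum is finite. *)
Definition opnorm (R : realType) (d : nat) (L : 'rV[R]_d -> 'rV[R]_d) : R :=
  sup [set enorm (L v) | v in [set v | enorm v <= 1]].

Definition dnorm (R : realType) (d : nat) (h : 'rV[R]_d -> 'rV[R]_d)
    (x : 'rV[R]_d) : R :=
  opnorm ('d h x).

Section HausdorffDimension.
Variables (R : realType) (d : nat).
Local Notation E := 'rV[R]_d.
Local Open Scope ereal_scope.

Definition diam (U : set E) : \bar R :=
  ereal_sup [set (enorm (p.1 - p.2)%R)%:E | p in U `*` U].

(* The empty set contributes 0, even for s = 0. *)
Definition diam_pow (s : R) (U : set E) : \bar R :=
  if `[< U = set0 >] then 0 else poweR (diam U) s.

Definition hausdorff_premeasure (s delta : R) (A : set E) : \bar R :=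
  ereal_inf [set \sum_(0 <= k <oo) diam_pow s (U k)
            | U in [set U : nat -> set E |
                     A `<=` \bigcup_k U k /\
                     forall k, diam (U k) <= delta%:E]].

Definition hausdorff_measure (s : R) (A : set E) : \bar R :=
  ereal_sup [set hausdorff_premeasure s delta A
            | delta in [set delta : R | (0 < delta)%R]].

Definition hausdorff_dim (A : set E) : \bar R :=
  ereal_inf [set s%:E
            | s in [set s : R | (0 <= s)%R /\ hausdorff_measure s A = 0]].

End HausdorffDimension.

(* A self-map of a subset X of R^d is represented by a total function on R^d whose values
   off X are irrelevant (except in [pressure], see there). *)
Section ConformalIFS.
Variables (R : realType) (d : nat) (I : countType).
Local Notation E := 'rV[R]_d.
Implicit Types (X V : set E) (s : I -> E -> E).

(* s_{w_1} \o ... \o s_{w_N} for w = [:: w_1; ...; w_N] *)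
Definition word_map s (w : seq I) : E -> E :=
  foldr (fun i h => s i \o h) id w.

Definition limit_set X s : set E :=
  \bigcup_(w in [set: nat -> I])
    \bigcap_(N in [set N | (0 < N)%N]) (word_map s (mkseq w N) @` X).

Definition Lip X (h : E -> E) : \bar R :=
  ereal_sup [set (enorm (h p.1 - h p.2) / enorm (p.1 - p.2))%:E
            | p in [set p | [/\ X p.1, X p.2 & p.1 <> p.2]]].

Definition is_ifs X s : Prop :=
  [/\ compact X /\ connected X,
      exists i j : I, i <> j,
      forall i, s i @` X `<=` X,
      forall i, set_inj X (s i) &
      (ereal_sup [set Lip X (s i) | i in [set: I]] < 1)%E].

Definition open_set_condition X s : Prop :=
  forall i j : I, i <> j -> (s i @` X°) `&` (s j @` X°) = set0.

Definition cone_condition X : Prop :=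
  exists alpha l : R,
    [/\ 0 < alpha, alpha < pi / 2, 0 < l &
      forall x, (closure X `\` X°) x ->
        exists2 u : E, u <> 0 &
          [set y | [/\ 0 < enorm (y - x), enorm (y - x) < l &
                       enorm (y - x) * enorm u * cos alpha < dotp (y - x) u]]
          `<=` X°].

Definition C1holder (eps : R) V (h : E -> E) : Prop :=
  (forall x, V x -> differentiable h x) /\
  (forall x, V x -> exists C : R,
     \forall y \near x & z \near x,
       opnorm (fun v => 'd h y v - 'd h z v) <= C * (enorm (y - z) `^ eps)).

(* diffeomorphism of V onto its (open) image *)
Definition C1holder_diffeo (eps : R) V (h : E -> E) : Prop :=
  [/\ C1holder eps V h, open (h @` V) &
      exists2 g : E -> E, {in V, cancel h g} & C1holder eps (h @` V) g].

Definition conformal_on V (h : E -> E) : Prop :=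
  forall x, V x ->
    exists2 lam : R, 0 < lam & forall v, enorm ('d h x v) = lam * enorm v.

(* The extensions map V into V, so that the compositions indexed by words, which
   occur in the distortion bound, are defined on V. *)
Definition conformality X s V (ext : I -> E -> E) : Prop :=
  [/\ open V, connected V, X `<=` V,
      forall i x, X x -> ext i x = s i x &
      exists2 eps : R, 0 < eps &
        forall i, [/\ ext i @` V `<=` V, C1holder_diffeo eps V (ext i) &
                      conformal_on V (ext i)]].

Definition bounded_distortion V (ext : I -> E -> E) : Prop :=
  exists2 K : R, 1 <= K &
    forall (w : seq I) x y, w != [::] -> V x -> V y ->
      dnorm (word_map ext w) y <= K * dnorm (word_map ext w) x.

Definition is_cifs X s : Prop :=
  [/\ is_ifs X s, open_set_condition X s, cone_condition X &
      exists V (ext : I -> E -> E),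
        conformality X s V ext /\ bounded_distortion V ext].

Definition partition_sum X s (t : R) (N : nat) : \bar R :=
  \esum_(w in [set: N.-tuple I])
    ereal_sup [set (dnorm (word_map s w) x `^ t)%:E | x in X].

(* The derivatives are taken on all of X, boundary included, so the total
   functions [s i] must be given by their conformal extension near X. *)
Definition pressure X s (t : R) : \bar R :=
  limn (fun N : nat => ((N%:R : R)^-1)%:E * lne (partition_sum X s t N))%E.

Definition regular X s : Prop := exists2 t : R, 0 <= t & pressure X s t = 0%E.

Definition irregular X s : Prop := ~ regular X s.

End ConformalIFS.

Section Systems.
Variable R : realType.
Local Open Scope complex_scope.

Definition toC (v : 'rV[R]_2) : R[i] := v 0 0 +i* v 0 1.

Definition ofC (z : R[i]) : 'rV[R]_2 :=
  \row_(k < 2) (if k == 0 then complex.Re z else complex.Im z).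

Definition expi (theta : R) : R[i] :=
  cos (2 * pi * theta) +i* sin (2 * pi * theta).

Definition closed_disc : set 'rV[R]_2 := [set v | enorm v <= 1].

Definition f_map (a z : R[i]) : R[i] := (z + a^*) / (`|a| ^+ 2 - 1).

Definition g_map (a z : R[i]) : R[i] := (z + a)^-1.

(* [d n] is the term of index n + 1 of the sequence. *)
Definition admissible (d : nat -> R) : Prop :=
  2 <= d 0%N /\ forall n, 2 <= d n.+1 - d n.

(* The parameters e(j/T) d_n are pairwise distinct when [d] is admissible and
   T > 0, so indexing the families by pairs (n, j) repeats no map. *)
Definition param (d : nat -> R) (T : nat) (i : nat * 'I_T) : R[i] :=
  expi ((i.2 : nat)%:R / T%:R) * (d i.1)%:C.

Definition Fsys (d : nat -> R) (T : nat) (i : nat * 'I_T) :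
    'rV[R]_2 -> 'rV[R]_2 :=
  fun v => ofC (f_map (param d i) (toC v)).

Definition Gsys (d : nat -> R) (T : nat) (i : nat * 'I_T) :
    'rV[R]_2 -> 'rV[R]_2 :=
  fun v => ofC (g_map (param d i) (toC v)).

End Systems.

Arguments closed_disc R : clear implicits.

(* Main.v *)
Require Import Defs.
From mathcomp Require Import all_boot all_order all_algebra.
From mathcomp Require Import all_classical all_reals all_analysis.
From mathcomp.real_closed Require Import complex.
From mathcomp.algebra_tactics Require Import ring lra.

Set Implicit Arguments.
Unset Strict Implicit.
Unset Printing Implicit Defensive.

Import Order.TTheory GRing.Theory Num.Theory.
Import numFieldNormedType.Exports.

Local Open Scope classical_set_scope.
Local Open Scope ring_scope.

(* The derivatives of the n-th maps of both systems are of order d_n^-2, so the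
   series of the t-th powers of the contraction ratios converges for the same t
   in both; let theta be the common abscissa of convergence.  Always
   dim J >= theta: when the series diverges at t, a finite subfamily of maps with
   separated images has lower Lipschitz constants c_i with sum c_i^t >= 1, and no
   cover of its limit set has small t-sum, by descent through the words.  In an
   irregular system dim J <= theta: the pressure is finite and continuous beyond
   theta and tends to -oo, so, never vanishing, it is negative there, and the
   covers by cylinders have t-sums tending to 0.  Equivalently, without theta:
   H^r(J) = 0 in one system bounds the series at r, and this forces H^t(J) = 0
   for all t > r in the other system if that one is irregular. *)

(** * Euclidean norm and words in a conformal system *)

(** For each a, [f_a] and [g_a] map the closed unit disc onto the same disc, of centre
    conj(a)/(|a|^2-1) and radius 1/(|a|^2-1); f_a is the affine parametrisation of it. This is why
    both systems fit one abstract record and one pair of coordinate bounds, and why a condition on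
    [d] alone, [even_sum_bounded], can carry information from one system to the other. The lower
    bound uses only the ray j = 0 and even indices. Nothing is lost: the contraction ratios decrease
    with n, so each odd term is at most the even term before it, and the T rotations only multiply
    the series by a constant. The pressure, a limit in the extended reals, is never studied as a
    function of t. Irregularity enters by contraposition: an exponent at which all partition sums
    lie between two positive constants is a zero of the pressure, and such an exponent is built from
    submultiplicativity, supermultiplicativity up to distortion, and convexity of the sums. *)

Section EuclideanNorm.
Variables (R : realType) (d : nat).
Implicit Types (u v w : 'rV[R]_d) (a : R).

Lemma dotpC u v : dotp u v = dotp v u.
Proof. by apply: eq_bigr => k _; rewrite mulrC. Qed.

Lemma dotpDl u v w : dotp (u + v) w = dotp u w + dotp v w.
Proof. by rewrite /dotp -big_split; apply: eq_bigr => k _; rewrite mxE mulrDl. Qed.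

Lemma dotpZl a u v : dotp (a *: u) v = a * dotp u v.
Proof. by rewrite /dotp mulr_sumr; apply: eq_bigr => k _; rewrite mxE mulrA. Qed.

Lemma dotp_ge0 u : 0 <= dotp u u.
Proof. by apply: sumr_ge0 => k _; rewrite -expr2 sqr_ge0. Qed.

Lemma dotp_eq0 u : dotp u u = 0 -> u = 0.
Proof.
move=> /psumr_eq0P u0; apply/rowP => k; rewrite mxE.
by apply/eqP; rewrite -sqrf_eq0 expr2 u0 // => j _; rewrite -expr2 sqr_ge0.
Qed.

Lemma enorm_ge0 u : 0 <= enorm u.
Proof. exact: sqrtr_ge0. Qed.

Lemma sqr_enorm u : enorm u ^+ 2 = dotp u u.
Proof. by rewrite sqr_sqrtr // dotp_ge0. Qed.

Lemma enorm0 : enorm (0 : 'rV[R]_d) = 0.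
Proof. by rewrite /enorm -(scale0r 0) dotpZl mul0r sqrtr0. Qed.

Lemma enorm_eq0 u : enorm u = 0 -> u = 0.
Proof. by move=> u0; apply: dotp_eq0; rewrite -sqr_enorm u0 expr0n. Qed.

Lemma enormZ a u : enorm (a *: u) = `|a| * enorm u.
Proof.
by rewrite /enorm dotpZl dotpC dotpZl mulrA -expr2 sqrtrM ?sqr_ge0 // sqrtr_sqr.
Qed.

Lemma enormN u : enorm (- u) = enorm u.
Proof. by rewrite -scaleN1r enormZ normrN1 mul1r. Qed.

Lemma enormC u v : enorm (u - v) = enorm (v - u).
Proof. by rewrite -enormN opprB. Qed.

(** Positivity of the squared norm of |v|^2 u - <u,v> v, which is |v|^2 times the Gram determinant
    of u and v. *)
Lemma Cauchy_Schwarz u v : dotp u v <= enorm u * enorm v.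
Proof.
have [->|v0] := eqVneq v 0.
  by rewrite enorm0 mulr0 dotpC -(scale0r 0) dotpZl mul0r.
have v_gt0 : 0 < enorm v.
  by rewrite lt_neqAle enorm_ge0 eq_sym andbT; apply: contra_neq v0 => /enorm_eq0.
have := dotp_ge0 (enorm v ^+ 2 *: u - dotp u v *: v).
rewrite -scaleNr !(dotpDl, dotpZl) ![dotp _ (_ + _)]dotpC !(dotpDl, dotpZl).
rewrite [dotp v u]dotpC -!sqr_enorm => H.
have {}H : 0 <= enorm v ^+ 2 * ((enorm u * enorm v) ^+ 2 - dotp u v ^+ 2).
  by apply: le_trans H _; rewrite le_eqVlt; apply/orP; left; apply/eqP; ring.
rewrite pmulr_rge0 ?exprn_gt0 // subr_ge0 in H.
have uv0 : 0 <= enorm u * enorm v by rewrite mulr_ge0 // enorm_ge0.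
by apply: le_trans (ler_norm _) _; rewrite -(@ler_pXn2r _ 2) ?nnegrE // real_normK ?num_real.
Qed.

Lemma ler_enormD u v : enorm (u + v) <= enorm u + enorm v.
Proof.
rewrite -(@ler_pXn2r _ 2) ?nnegrE ?addr_ge0 ?enorm_ge0 //.
rewrite sqr_enorm dotpDl ![dotp _ (_ + _)]dotpC !dotpDl [dotp v u]dotpC -!sqr_enorm.
by have := Cauchy_Schwarz u v; rewrite sqrrD -mulr_natr; lra.
Qed.

Lemma ler_enormB_add u v w : enorm (u - w) <= enorm (u - v) + enorm (v - w).
Proof. by apply: le_trans (ler_enormD _ _); rewrite addrA subrK. Qed.

End EuclideanNorm.

(** Dimension [d.+1] provides the unit vector [delta_mx 0 0], at which the supremum is attained. *)
Lemma opnorm_conformal (R : realType) (d : nat)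
    (L : 'rV[R]_d.+1 -> 'rV[R]_d.+1) (a : R) :
  0 <= a -> (forall v, enorm (L v) = a * enorm v) -> opnorm L = a.
Proof.
move=> a0 La; rewrite /opnorm; set A := [set _ | _ in _].
have e1 : enorm (delta_mx 0 0 : 'rV[R]_d.+1) = 1.
  rewrite /enorm /dotp (bigD1 ord0) //= big1 => [|k k0]; last first.
    by rewrite !mxE (negPf k0) andbF mulr0.
  by rewrite !mxE !eqxx mulr1 addr0 sqrtr1.
have Aa : A a by exists (delta_mx 0 0); rewrite /= ?La e1 ?mulr1.
apply/eqP; rewrite eq_le; apply/andP; split.
  apply: ge_sup; first by exists a.
  by move=> _ [v /= v1 <-]; rewrite La ler_piMr.
apply: ub_le_sup => //; exists a => _ [v /= v1 <-].
by rewrite La ler_piMr.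
Qed.

(* [lam i] is the norm of the derivative of [s i].  [ms_dist] is the square of
   |s x - s y| = |x - y| (lam x lam y)^(1/2), an identity valid for similarities
   and for Moebius maps, and stable under composition. *)
Record mobius_system (R : realType) (d : nat) (I : countType)
    (X : set 'rV[R]_d) (s : I -> 'rV[R]_d -> 'rV[R]_d)
    (lam : I -> 'rV[R]_d -> R) (rho C D : R) : Prop := MobiusSystem {
  ms_compact : compact X;
  ms_nonempty : X !=set0;
  ms_diam : forall x y, X x -> X y -> enorm (x - y) <= D;
  ms_stable : forall i x, X x -> X (s i x);
  ms_rho : 0 < rho < 1;
  ms_C : 0 <= C;
  ms_gt0 : forall i x, X x -> 0 < lam i x;
  ms_le : forall i x, X x -> lam i x <= rho;
  ms_dist : forall i x y, X x -> X y ->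
    dotp (s i x - s i y) (s i x - s i y) =
    dotp (x - y) (x - y) * (lam i x * lam i y);
  ms_distort : forall i x y, X x -> X y ->
    lam i x <= lam i y * expR (C * enorm (x - y));
  ms_diff : forall i x, X x -> differentiable (s i) x;
  ms_conformal : forall i x v, X x ->
    enorm ('d (s i) x v) = lam i x * enorm v }.

Section Words.
Variables (R : realType) (d : nat) (I : countType).
Variables (X : set 'rV[R]_d.+1) (s : I -> 'rV[R]_d.+1 -> 'rV[R]_d.+1).
Variables (lam : I -> 'rV[R]_d.+1 -> R) (rho C D : R).
Hypothesis ms : mobius_system X s lam rho C D.
Implicit Types (w : seq I) (x y : 'rV[R]_d.+1).

(** The chain rule product along the orbit of [x]; [dnorm_word] identifies it with the norm of the
    derivative of the word. *)
Fixpoint lam_word w x : R :=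
  if w is i :: w' then lam i (word_map s w' x) * lam_word w' x else 1.

Lemma word_map_cat v w x : word_map s (v ++ w) x = word_map s v (word_map s w x).
Proof. by elim: v => //= i v ->. Qed.

Lemma word_map_rcons w i x : word_map s (rcons w i) x = word_map s w (s i x).
Proof. by rewrite -cats1 word_map_cat. Qed.

Lemma lam_word_cat v w x :
  lam_word (v ++ w) x = lam_word v (word_map s w x) * lam_word w x.
Proof.
by elim: v => [|i v IH] /=; rewrite ?mul1r // IH word_map_cat mulrA.
Qed.

Lemma word_map_stable w x : X x -> X (word_map s w x).
Proof. by move=> Xx; elim: w => //= i w; apply: (ms_stable ms). Qed.

Lemma rho_gt0 : 0 < rho. Proof. by case/andP: (ms_rho ms). Qed.
Lemma rho_lt1 : rho < 1. Proof. by case/andP: (ms_rho ms). Qed.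
Lemma rho_ge0 : 0 <= rho. Proof. exact: ltW rho_gt0. Qed.
Hint Resolve rho_ge0 : core.

Lemma diam_ge0 : 0 <= D.
Proof. by case: (ms_nonempty ms) => x Xx; apply: le_trans (enorm_ge0 _) (ms_diam ms Xx Xx). Qed.

Lemma lam_word_gt0 w x : X x -> 0 < lam_word w x.
Proof.
move=> Xx; elim: w => [|i w IH] /=; first exact: ltr01.
rewrite mulr_gt0 //.
by apply: (ms_gt0 ms); apply: word_map_stable.
Qed.

Lemma lam_word_le w x : X x -> lam_word w x <= rho ^+ size w.
Proof.
move=> Xx; elim: w => //= i w IH; rewrite exprS ler_pM //.
- by apply: ltW; apply: (ms_gt0 ms); apply: word_map_stable.
- exact/ltW/lam_word_gt0.
- by apply: (ms_le ms); apply: word_map_stable.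
Qed.

Lemma dist_word w x y : X x -> X y ->
  dotp (word_map s w x - word_map s w y) (word_map s w x - word_map s w y) =
  dotp (x - y) (x - y) * (lam_word w x * lam_word w y).
Proof.
move=> Xx Xy; elim: w => [|i w IH] /=; first by rewrite !mulr1.
by rewrite (ms_dist ms) ?IH; [ring| exact: word_map_stable ..].
Qed.

(** The distance identity involves the two endpoints only, so no path from [x] to [y] inside [X]
    enters the Lipschitz bound. *)
Lemma dist_word_le w x y a : X x -> X y -> lam_word w x <= a -> lam_word w y <= a ->
  enorm (word_map s w x - word_map s w y) <= a * enorm (x - y).
Proof.
move=> Xx Xy xa ya; have a0 := le_trans (ltW (lam_word_gt0 w Xx)) xa.
rewrite -(@ler_pXn2r _ 2) ?nnegrE ?mulr_ge0 ?enorm_ge0 //.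
rewrite exprMn !sqr_enorm dist_word // mulrC ler_wpM2r ?dotp_ge0 //.
by rewrite expr2 ler_pM // ltW // lam_word_gt0.
Qed.

Lemma word_contract w x y : X x -> X y ->
  enorm (word_map s w x - word_map s w y) <= rho ^+ size w * D.
Proof.
move=> Xx Xy; apply: le_trans (dist_word_le Xx Xy (lam_word_le w Xx) (lam_word_le w Xy)) _.
by rewrite ler_wpM2l ?exprn_ge0 // (ms_diam ms).
Qed.

(* Peeling off the innermost map makes the exponents add up to the fixed point
   C' = C' rho + C. *)
Lemma lam_word_distort_exp w x y : X x -> X y ->
  lam_word w x <= lam_word w y * expR (C / (1 - rho) * enorm (x - y)).
Proof.
have r1 : 0 < 1 - rho by rewrite subr_gt0 rho_lt1.
have C0 := ms_C ms.
elim/last_ind: w x y => [|w i IH] x y Xx Xy /=.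
  by rewrite mul1r -[leLHS]expR0 ler_expR !mulr_ge0 ?enorm_ge0 // invr_ge0 ltW.
rewrite -cats1 !lam_word_cat /= !mulr1.
have Xsx := ms_stable ms i Xx; have Xsy := ms_stable ms i Xy.
apply: (@le_trans _ _ (lam_word w (s i y) * expR (C / (1 - rho) * enorm (s i x - s i y))
    * (lam i y * expR (C * enorm (x - y))))).
  apply: ler_pM; [exact/ltW/lam_word_gt0|by apply: ltW; apply: (ms_gt0 ms)|exact: IH|].
  exact: (ms_distort ms).
rewrite mulrACA ler_wpM2l //.
  by rewrite mulr_ge0 // ltW // ?lam_word_gt0 ?(ms_gt0 ms).
rewrite -expRD ler_expR.
have sxy : enorm (s i x - s i y) <= rho * enorm (x - y).
  by have := @dist_word_le [:: i] x y rho Xx Xy; rewrite /= !mulr1; apply; apply: (ms_le ms).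
apply: (@le_trans _ _ (C / (1 - rho) * (rho * enorm (x - y)) + C * enorm (x - y))).
  by rewrite lerD2r ler_wpM2l // divr_ge0 // ltW.
by rewrite le_eqVlt; apply/orP; left; apply/eqP; field; rewrite gt_eqF.
Qed.

Definition distortion : R := expR (C / (1 - rho) * D).

Lemma distortion_ge1 : 1 <= distortion.
Proof.
rewrite -[leLHS]expR0 ler_expR mulr_ge0 ?diam_ge0 // divr_ge0 ?(ms_C ms) //.
by rewrite subr_ge0 ltW // rho_lt1.
Qed.

Lemma lam_word_distort w x y : X x -> X y -> lam_word w x <= distortion * lam_word w y.
Proof.
move=> Xx Xy; apply: le_trans (lam_word_distort_exp w Xx Xy) _.
rewrite mulrC ler_wpM2r ?(ltW (lam_word_gt0 _ _)) // ler_expR ler_wpM2l ?(ms_diam ms) //.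
by rewrite divr_ge0 ?(ms_C ms) // subr_ge0 ltW // rho_lt1.
Qed.

Lemma differentiable_word w x : X x -> differentiable (word_map s w) x.
Proof.
move=> Xx; elim: w => [|i w IH]; first exact: ex_diff.
by apply: differentiable_comp => //; apply: (ms_diff ms); apply: word_map_stable.
Qed.

Lemma diff_word w x v : X x -> enorm ('d (word_map s w) x v) = lam_word w x * enorm v.
Proof.
move=> Xx; elim: w => [|i w IH]; first by rewrite mul1r diff_val.
rewrite /= diff_comp; [|exact: differentiable_word|by apply: (ms_diff ms); apply: word_map_stable].
by rewrite /= (ms_conformal ms) ?IH ?mulrA //; apply: word_map_stable.
Qed.

Lemma dnorm_word w x : X x -> dnorm (word_map s w) x = lam_word w x.
Proof.
move=> Xx; apply: opnorm_conformal; first exact/ltW/lam_word_gt0.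
by move=> v; rewrite diff_word.
Qed.

(** A cluster point of the images of one base point: each cylinder contains a tail of this sequence
    and, being compact, is closed. *)
Lemma word_limit_point (om : nat -> I) : exists x,
  forall N, (word_map s (mkseq om N) @` X) x.
Proof.
have [x0 Xx0] := ms_nonempty ms.
pose u N := word_map s (mkseq om N) x0.
have uX N M : (N <= M)%N -> (word_map s (mkseq om N) @` X) (u M).
  move=> NM; exists (word_map s (mkseq (fun k => om (N + k)%N) (M - N)) x0).
    exact: word_map_stable.
  rewrite -word_map_cat /u; congr (word_map _ _ _).
  rewrite /mkseq -[in RHS](subnKC NM) iotaD map_cat add0n; congr (_ ++ _).
  have -> : iota N (M - N) = map (addn N) (iota 0 (M - N)) by rewrite -iotaDl addn0.
  by rewrite -map_comp.
have FX : (u @ \oo) X by exists 0%N => // N _; apply: word_map_stable.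
have [x [Xx ux]] := @ms_compact _ _ _ _ _ _ _ _ _ ms (u @ \oo) _ FX.
exists x => N.
have cN : closed (word_map s (mkseq om N) @` X).
  apply: compact_closed; first exact: norm_hausdorff.
  apply: continuous_compact (ms_compact ms).
  apply: continuous_in_subspaceT => y; rewrite inE => Xy.
  exact/differentiable_continuous/differentiable_word.
apply: cN => B Bx; apply: ux => //.
by exists N => // M /= NM; apply: uX.
Qed.

End Words.

(** * Partition functions and the critical exponent *)

(** Weighted average of the tangent inequality of exp at the convex combination [m] of x ln a and y
    ln a; the linear terms cancel. *)
Lemma powR_convex (R : realType) (a e x y : R) : 0 < a -> 0 <= e <= 1 ->
  a `^ ((1 - e) * x + e * y) <= (1 - e) * a `^ x + e * a `^ y.
Proof.
move=> a0 /andP[e0 e1]; rewrite /powR gt_eqF //.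
set m := (_ * x + _) * _.
have H z : expR m * (1 + (z * ln a - m)) <= expR (z * ln a).
  have -> : expR (z * ln a) = expR m * expR (z * ln a - m).
    by rewrite -expRD; congr expR; ring.
  by rewrite ler_wpM2l ?expR_ge0 // expR_ge1Dx.
apply: (@le_trans _ _ ((1 - e) * (expR m * (1 + (x * ln a - m)))
                       + e * (expR m * (1 + (y * ln a - m))))).
  by rewrite le_eqVlt; apply/orP; left; apply/eqP; rewrite /m; ring.
by apply: lerD; apply: ler_wpM2l => //; rewrite subr_ge0.
Qed.

(** * The critical exponent, from the algebraic properties of partition sums alone *)

Section CriticalExponent.
Variables (R : realType) (z : R -> nat -> R) (s K rho : R).
Hypothesis s0 : 0 <= s.
Hypothesis K1 : 1 <= K.
Hypothesis rho01 : 0 < rho < 1.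
Hypothesis z_ge0 : forall t N, s <= t -> 0 <= z t N.
Hypothesis z0 : forall t, s <= t -> z t 0%N = 1.
Hypothesis z_submul : forall t N M, s <= t -> z t (N + M)%N <= z t N * z t M.
Hypothesis z_supmul : forall t N M, s <= t -> z t N * z t M <= K `^ t * z t (N + M)%N.
Hypothesis z_decr : forall t u N, s <= t -> t <= u ->
  z u N <= (rho `^ (u - t)) ^+ N * z t N.
Hypothesis z_convex : forall t N (e : R), s <= t -> 0 <= e <= 1 ->
  z ((1 - e) * t + e * s) N <= (1 - e) * z t N + e * z s N.

Lemma z_mulr_le t N k : s <= t -> z t (k * N)%N <= z t N ^+ k.
Proof.
move=> st; elim: k => [|k IH]; first by rewrite mul0n z0.
by rewrite mulSn exprS (le_trans (z_submul _ _ st)) // ler_wpM2l // z_ge0.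
Qed.

Lemma z_exp_le t N k : s <= t -> z t N ^+ k <= (K `^ t) ^+ k * z t (k * N)%N.
Proof.
move=> st; elim: k => [|k IH]; first by rewrite mul0n z0 // mulr1.
rewrite mulSn !exprS; apply: le_trans (ler_wpM2l (z_ge0 _ st) IH) _.
by rewrite mulrCA [K `^ t * _]mulrC -mulrA ler_wpM2l ?exprn_ge0 ?powR_ge0 // z_supmul.
Qed.

(* t is the infimum of the u with z u N < 1 for some N.  Convexity replaces
   continuity in the exponent: z t N < 1 would propagate below t, and
   z t N > K^(t+1) would give z u N >= K^u for some u > t with z u M < 1, so that
   z u (N M) >= 1 and z u (N M) < 1. *)
Lemma critical_exponent t0 : s < t0 -> (forall N, 1 <= z t0 N) ->
  exists2 t, s < t & forall N, 1 <= z t N <= K `^ (t + 1).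
Proof.
move=> st0 zt0; have [rho0 rho1] := andP rho01.
have K0 : 0 < K by apply: lt_le_trans K1.
pose A : set R := [set t | s <= t /\ exists N, z t N < 1].
have rho_le1 t u N : s <= t -> t <= u -> z u N <= z t N.
  move=> st tu; apply: le_trans (z_decr N st tu) _.
  rewrite -[leRHS]mul1r ler_wpM2r ?z_ge0 // exprn_ile1 ?powR_ge0 //.
  rewrite -(powRr0 rho) ger_powR ?rho0 ?(ltW rho1) //; lra.
have A0 : A !=set0.
  (* With this [u], rho^u = exp(- z s 1), and x < exp x gives a value below 1. *)
  pose u := z s 1 / - ln rho; have ln0 : ln rho < 0 by rewrite ln_lt0 ?rho0.
  have u0 : 0 <= u by rewrite divr_ge0 ?z_ge0 // oppr_ge0 ltW.
  exists (s + u); split; first by rewrite lerDl.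
  exists 1%N; have su : s <= s + u by rewrite lerDl.
  apply: le_lt_trans (z_decr _ (lexx s) su) _; rewrite expr1.
  have -> : s + u - s = u by ring.
  rewrite /powR gt_eqF // /u -mulrA invrN mulNr mulVf ?lt_eqF // mulrN1 expRN.
  rewrite mulrC ltr_pdivrMr ?expR_gt0 // mul1r.
  by apply: lt_le_trans (expR_ge1Dx _); rewrite ltrDr.
have lbA : lbound A t0.
  move=> t [st [N ztN]]; rewrite leNgt; apply/negP => /ltW tt0.
  by have := le_trans (zt0 N) (rho_le1 _ _ N st tt0); rewrite leNgt ztN.
have hA : has_inf A by split=> //; exists t0.
pose t1 := inf A.
have t01 : t0 <= t1 by apply: lb_le_inf.
have st1 : s < t1 by apply: lt_le_trans t01.
have A_ge t : A t -> t1 <= t by move=> At; apply: ge_inf => //; exists t0.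
have z1 N : 1 <= z t1 N.
  rewrite leNgt; apply/negP => zlt.
  have zs0 := z_ge0 N (lexx s).
  have p0 : 0 < 1 - z t1 N + z s N + 1 by lra.
  (* A weight for which e * z s N stays below the gap 1 - z t1 N; the extra 1 in the denominator
     keeps e < 1 even if z s N = 0. *)
  pose e := (1 - z t1 N) / (1 - z t1 N + z s N + 1).
  have e0 : 0 < e by rewrite divr_gt0 // subr_gt0.
  have e1 : e < 1 by rewrite ltr_pdivrMr //; lra.
  have ezs : e * z s N < 1 - z t1 N.
    rewrite /e mulrAC ltr_pdivrMr // ltr_pM2l ?subr_gt0 //; lra.
  suff : t1 <= (1 - e) * t1 + e * s by nra.
  apply: A_ge; split; first by nra.
  exists N; apply: le_lt_trans (z_convex _ (ltW st1) _) _; first by lra.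
  have := z_ge0 N (ltW st1); nra.
exists t1 => // N; rewrite z1 /= leNgt; apply/negP => zgt.
have N0 : (0 < N)%N.
  rewrite lt0n; apply/negP => /eqP N0; move: zgt.
  rewrite N0 z0 ?(ltW st1) // ltNge => /negP; apply.
  rewrite -[leLHS](powRr0 K) ler_powR //.
  by move: s0 st1; lra.
pose g := z t1 N - K `^ (t1 + 1).
have g0 : 0 < g by rewrite subr_gt0.
have zs0 := z_ge0 N (lexx s).
have st1' : 0 < t1 - s by rewrite subr_gt0.
(* The cap 1 keeps t <= t1 + 1, hence K^t <= K^(t1 + 1): this is the origin of the exponent t + 1.
   The other bound keeps the loss in the convexity inequality between s and t below the gap [g]. *)
pose h := Num.min 1 (g * (t1 - s) / (z s N + 1)).
have h0 : 0 < h by rewrite lt_min ltr01 divr_gt0 ?mulr_gt0 // ltr_wpDl.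
have [t At tlt] : exists2 t, A t & t < t1 + h.
  by have [t At tlt] := inf_adherent h0 hA; exists t.
have t1t := A_ge _ At; have [st [M ztM]] := At.
have tlt1 : t <= t1 + 1 by apply: ltW; apply: lt_le_trans tlt _; rewrite lerD2l ge_min lexx.
have tg : (t - t1) * z s N <= g * (t1 - s).
  apply: (@le_trans _ _ (g * (t1 - s) / (z s N + 1) * z s N)).
    rewrite ler_wpM2r // lerBlDl; apply: le_trans (ltW tlt) _.
    by rewrite lerD2l ge_min lexx orbT.
  rewrite mulrAC ler_pdivrMr ?ltr_wpDl // ler_wpM2l; [by []| |by rewrite lerDl].
  by rewrite mulr_ge0 // ltW.
have ztN : K `^ t <= z t N.
  apply: (@le_trans _ _ (K `^ (t1 + 1))); first exact: ler_powR.
  pose e := (t - t1) / (t - s).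
  have ts : 0 < t - s by lra.
  have e0 : 0 <= e <= 1.
    rewrite divr_ge0 ?subr_ge0 //= ?ler_pdivrMr //; lra.
  have := z_convex N st e0.
  have -> : (1 - e) * t + e * s = t1 by rewrite /e; field; rewrite gt_eqF.
  have ezs : e * z s N <= g.
    rewrite /e mulrAC ler_pdivrMr //; apply: le_trans tg _; rewrite ler_wpM2l ?(ltW g0) //; lra.
  have := z_ge0 N st; rewrite /g in ezs *; case/andP: e0 => e0 e1; nra.
have zNM : 1 <= z t (M * N)%N.
  have := z_exp_le N M st.
  have KM : 0 < (K `^ t) ^+ M by rewrite exprn_gt0 // powR_gt0.
  rewrite -(ler_pM2l KM) mulr1; apply: le_trans.
  by rewrite lerXn2r // nnegrE ?powR_ge0 // z_ge0.
have := le_trans zNM (eq_ind _ (fun j => z t j <= _) (z_mulr_le M N st) _ (mulnC N M)).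
by rewrite leNgt exprn_ilt1 ?z_ge0 // -lt0n N0.
Qed.

End CriticalExponent.

Section SumLemmas.
Variables (R : realType) (I : choiceType).
Local Open Scope ereal_scope.

(** One inequality is proved for every positive factor; the reverse one is the same inequality for
    the inverse factor. *)
Lemma esumZl (a : I -> \bar R) (k : R) : (0 <= k)%R -> (forall i, 0 <= a i) ->
  \esum_(i in [set: I]) (k%:E * a i) = k%:E * \esum_(i in [set: I]) a i.
Proof.
rewrite le_eqVlt => /predU1P[<-|k0] a0.
  by rewrite mul0e esum1 // => i _; rewrite mul0e.
have H (b : I -> \bar R) (c : R) : (0 < c)%R -> (forall i, 0 <= b i) ->
    \esum_(i in [set: I]) (c%:E * b i) <= c%:E * \esum_(i in [set: I]) b i.
  move=> c0 b0; apply: ge_ereal_sup => _ [A [finA _] <-].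
  rewrite -ge0_mule_fsumr // lee_pmul2l //.
  by apply: ereal_sup_ubound; exists A.
apply/eqP; rewrite eq_le H //=.
have := H (fun i => k%:E * a i) (k^-1)%R.
have kE : 0 <= k%:E by rewrite lee_fin ltW.
rewrite invr_gt0 => /(_ k0 (fun i => mule_ge0 kE (a0 i))).
under eq_esum do rewrite muleA -EFinM mulVf ?gt_eqF // mul1e.
by move=> /(lee_wpmul2l kE); rewrite muleA -EFinM divff ?gt_eqF // mul1e.
Qed.

Lemma esum_tuple_cat (N M : nat) (a : seq I -> \bar R) : (forall w, 0 <= a w) ->
  \esum_(w in [set: (N + M).-tuple I]) a w =
  \esum_(v in [set: N.-tuple I]) \esum_(w in [set: M.-tuple I]) a (v ++ w).
Proof.
move=> a0; rewrite (esum_esum (fun (v : N.-tuple I) (w : M.-tuple I) _ _ => a0 (v ++ w))).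
rewrite (_ : [set: N.-tuple I] `*`` _ = setT); last by apply/seteqP; split=> -[].
rewrite (reindex_esum [set: N.-tuple I * M.-tuple I] _ (fun p => [tuple of p.1 ++ p.2])) //.
split => //.
  move=> [v w] [v' w'] _ _ /= /(congr1 val) /= /eqP.
  rewrite eqseq_cat ?size_tuple // => /andP[/eqP vv /eqP ww].
  by congr pair; apply: val_inj.
move=> t _; have tN : size (take N t) == N by rewrite size_takel // size_tuple leq_addr.
have tM : size (drop N t) == M by rewrite size_drop size_tuple addKn.
by exists (Tuple tN, Tuple tM) => //; apply: val_inj; rewrite /= cat_take_drop.
Qed.

End SumLemmas.

(** * The partition function and its multiplicative properties *)

Section HausdorffUpper.
Variables (R : realType) (d : nat) (I : countType).
Variables (X : set 'rV[R]_d.+1) (s : I -> 'rV[R]_d.+1 -> 'rV[R]_d.+1).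
Variables (lam : I -> 'rV[R]_d.+1 -> R) (rho C D : R).
Hypothesis ms : mobius_system X s lam rho C D.
Implicit Types (w v : seq I) (x y : 'rV[R]_d.+1).

Local Notation lamw := (lam_word s lam).
Local Notation K := (distortion rho C D).

Definition sup_lam w : R := sup [set lamw w x | x in X].

Lemma le_sup_lam w x : X x -> lamw w x <= sup_lam w.
Proof.
move=> Xx; apply: ub_le_sup; last by exists x.
by exists (rho ^+ size w) => _ [y Xy <-]; apply: (lam_word_le ms).
Qed.

Lemma sup_lam_le w a : (forall x, X x -> lamw w x <= a) -> sup_lam w <= a.
Proof.
have [x Xx] := ms_nonempty ms.
by move=> H; apply: ge_sup; [exists (lamw w x), x|move=> _ [y Xy <-]; apply: H].
Qed.

Lemma sup_lam_gt0 w : 0 < sup_lam w.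
Proof.
have [x Xx] := ms_nonempty ms.
exact: lt_le_trans (lam_word_gt0 ms w Xx) (le_sup_lam w Xx).
Qed.

Lemma sup_lam_rho w : sup_lam w <= rho ^+ size w.
Proof. by apply: sup_lam_le => x Xx; apply: (lam_word_le ms). Qed.

Lemma sup_lam_distort w x : X x -> sup_lam w <= K * lamw w x.
Proof. by move=> Xx; apply: sup_lam_le => y Xy; apply: (lam_word_distort ms). Qed.

Lemma sup_lam_cat_le v w : sup_lam (v ++ w) <= sup_lam v * sup_lam w.
Proof.
apply: sup_lam_le => x Xx; rewrite lam_word_cat.
have Xwx := word_map_stable ms w Xx.
by apply: ler_pM; rewrite ?(ltW (lam_word_gt0 ms _ _)) ?le_sup_lam.
Qed.

(** The factor of [v] is evaluated at the image of [x] under [w], a point of [X], where distortion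
    keeps it within [K] of its supremum. *)
Lemma sup_lam_cat_ge v w : sup_lam v * sup_lam w <= K * sup_lam (v ++ w).
Proof.
rewrite mulrC -ler_pdivlMr ?sup_lam_gt0 //; apply: sup_lam_le => x Xx.
rewrite ler_pdivlMr ?sup_lam_gt0 // mulrC.
have Xwx := word_map_stable ms w Xx.
apply: (@le_trans _ _ (K * lamw v (word_map s w x) * lamw w x)).
  by rewrite ler_wpM2r ?(ltW (lam_word_gt0 ms _ _)) // sup_lam_distort.
rewrite -mulrA -lam_word_cat ler_wpM2l ?le_sup_lam // expR_ge0 //.
Qed.

(** A substitute for [partition_sum] with the supremum taken before the power. The two agree up to
    the factor K^t, which is enough for the pressure. *)
Definition zeta (t : R) (N : nat) : \bar R :=
  \esum_(w in [set: N.-tuple I]) (sup_lam w `^ t)%:E.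

Lemma zeta_ge0 t N : (0 <= zeta t N)%E.
Proof. by apply: esum_ge0 => w _; rewrite lee_fin powR_ge0. Qed.

Lemma zeta0 t : zeta t 0 = 1%E.
Proof.
rewrite /zeta (_ : setT = [set [tuple]]); last first.
  by apply/seteqP; split => // w _; rewrite [w]tuple0.
rewrite esum_set1 ?lee_fin ?powR_ge0 //=.
have [x Xx] := ms_nonempty ms.
rewrite (_ : sup_lam [::] = 1) ?powR1 //.
apply/eqP; rewrite eq_le -{2}[1]/(lamw [::] x) le_sup_lam // andbT.
by apply: sup_lam_le.
Qed.

Lemma zeta_mul t N M : (zeta t M < +oo)%E ->
  (\esum_(v in [set: N.-tuple I]) \esum_(w in [set: M.-tuple I])
     (sup_lam v `^ t * sup_lam w `^ t)%:E = zeta t N * zeta t M)%E.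
Proof.
move=> fM; have fM' : zeta t M \is a fin_num by rewrite ge0_fin_numE ?zeta_ge0.
under eq_esum => v _.
  under eq_esum do rewrite EFinM.
  rewrite esumZl ?powR_ge0 //; last by move=> i; rewrite lee_fin powR_ge0.
  rewrite -[X in (_ * X)%E]/(zeta t M) -(fineK fM') muleC.
  over.
rewrite esumZl ?fine_ge0 ?zeta_ge0 //; last by move=> i; rewrite lee_fin powR_ge0.
by rewrite fineK // muleC.
Qed.

Lemma zeta_submul t N M : 0 <= t -> (zeta t M < +oo)%E ->
  (zeta t (N + M) <= zeta t N * zeta t M)%E.
Proof.
move=> t0 fM; rewrite -zeta_mul // /zeta (@esum_tuple_cat _ _ N M (fun w => (sup_lam w `^ t)%:E)); last first.
  by move=> w; rewrite lee_fin powR_ge0.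
apply: le_esum => v _; apply: le_esum => w _; rewrite lee_fin.
rewrite -powRM ?(ltW (sup_lam_gt0 _)) //.
by rewrite ge0_ler_powR ?nnegrE ?mulr_ge0 ?(ltW (sup_lam_gt0 _)) // sup_lam_cat_le.
Qed.

Lemma zeta_supmul t N M : 0 <= t -> (zeta t M < +oo)%E ->
  (zeta t N * zeta t M <= (K `^ t)%:E * zeta t (N + M))%E.
Proof.
move=> t0 fM; rewrite -zeta_mul // /zeta.
rewrite -esumZl ?powR_ge0 //; last by move=> i; rewrite lee_fin powR_ge0.
rewrite (@esum_tuple_cat _ _ N M (fun w => (K `^ t)%:E * (sup_lam w `^ t)%:E)%E); last first.
  by move=> w; rewrite mule_ge0 // lee_fin powR_ge0.
apply: le_esum => v _; apply: le_esum => w _; rewrite lee_fin.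
have K0 : 0 <= K by rewrite expR_ge0.
rewrite -!powRM ?(ltW (sup_lam_gt0 _)) //.
by rewrite ge0_ler_powR ?nnegrE ?mulr_ge0 ?(ltW (sup_lam_gt0 _)) // sup_lam_cat_ge.
Qed.

Lemma zeta_decr t u N : t <= u ->
  (zeta u N <= ((rho `^ (u - t)) ^+ N)%:E * zeta t N)%E.
Proof.
move=> tu; rewrite /zeta -esumZl ?exprn_ge0 ?powR_ge0 //; last first.
  by move=> i; rewrite lee_fin powR_ge0.
apply: le_esum => w _; rewrite lee_fin.
have -> : sup_lam w `^ u = sup_lam w `^ (u - t) * sup_lam w `^ t.
  by rewrite -powRD ?subrK // (gt_eqF (sup_lam_gt0 _)) implybT.
rewrite ler_wpM2r ?powR_ge0 // -powR_mulrn ?powR_ge0 // -powRrM mulrC powRrM.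
rewrite powR_mulrn ?(rho_ge0 ms) //.
rewrite ge0_ler_powR ?subr_ge0 ?nnegrE ?exprn_ge0 ?(rho_ge0 ms) ?(ltW (sup_lam_gt0 _)) //.
by rewrite -{2}(size_tuple w) sup_lam_rho.
Qed.

Lemma zeta_convex t u N e : 0 <= e <= 1 ->
  (zeta ((1 - e) * t + e * u) N <= (1 - e)%:E * zeta t N + e%:E * zeta u N)%E.
Proof.
move=> e01; have [e0 e1] := andP e01.
have p (v : R) (w : N.-tuple I) : (0 <= (sup_lam w `^ v)%:E)%E by rewrite lee_fin powR_ge0.
rewrite /zeta -!esumZl ?subr_ge0 // -esumD.
- by apply: le_esum => w _; rewrite lee_fin powR_convex ?sup_lam_gt0.
- by move=> w _; rewrite mule_ge0 // lee_fin subr_ge0.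
- by move=> w _; rewrite mule_ge0.
Qed.

Lemma zeta_fin t u N : 0 <= t -> t <= u -> (zeta t 1 < +oo)%E -> (zeta u N < +oo)%E.
Proof.
move=> t0 tu f1; elim: N => [|N IH]; first by rewrite zeta0 ltry.
have fu1 : (zeta u 1 < +oo)%E.
  apply: le_lt_trans (zeta_decr _ tu) _.
  by rewrite lte_mul_pinfty ?lee_fin ?exprn_ge0 ?powR_ge0.
rewrite -addn1; apply: le_lt_trans (zeta_submul _ (le_trans t0 tu) fu1) _.
rewrite -(@fineK _ (zeta u 1)) ?ge0_fin_numE ?zeta_ge0 // muleC.
by rewrite lte_mul_pinfty ?lee_fin ?fine_ge0 ?zeta_ge0.
Qed.

End HausdorffUpper.

(** * Upper bound for the Hausdorff measure *)

Section HausdorffBasics.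
Variables (R : realType) (d : nat).
Implicit Types (t : R) (A : set 'rV[R]_d).
Local Open Scope ereal_scope.

Lemma diam_pow_ge0 t A : 0 <= diam_pow t A.
Proof. by rewrite /diam_pow; case: asboolP => // _; apply: poweR_ge0. Qed.

Lemma hausdorff_premeasure_ge0 t (delta : R) A : 0 <= hausdorff_premeasure t delta A.
Proof.
apply: le_ereal_inf_tmp => _ [U _ <-]; apply: nneseries_ge0 => k _ _.
exact: diam_pow_ge0.
Qed.

Lemma hausdorff_measure_ge0 t A : 0 <= hausdorff_measure t A.
Proof.
apply: le_trans (hausdorff_premeasure_ge0 t 1 A) _.
by apply: ereal_sup_ubound; exists 1%R => //=.
Qed.

Lemma diam_pow_le t A (a : R) : (0 <= t)%R -> (0 <= a)%R ->
  (forall x y, A x -> A y -> (enorm (x - y) <= a)%R) -> diam_pow t A <= (a `^ t)%:E.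
Proof.
move=> t0 a0 Aa; rewrite /diam_pow; case: asboolP => [_|/eqP/set0P[x Ax]].
  by rewrite lee_fin powR_ge0.
have dA : diam A <= a%:E.
  by apply: ge_ereal_sup => _ [p [Ap Aq] <-]; rewrite lee_fin; apply: Aa.
have d0 : 0 <= diam A.
  apply: le_trans (_ : 0 <= (enorm (x - x))%:E) _; first by rewrite lee_fin enorm_ge0.
  by apply: ereal_sup_ubound; exists (x, x).
by rewrite -poweR_EFin gt0_ler_poweR // in_itv /= ?d0 ?lee_fin ?a0 ?leey.
Qed.

Lemma diam_le A (a : R) :
  (forall x y, A x -> A y -> (enorm (x - y) <= a)%R) -> diam A <= a%:E.
Proof.
by move=> Aa; apply: ge_ereal_sup => _ [p [Ap Aq] <-]; rewrite lee_fin; apply: Aa.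
Qed.

End HausdorffBasics.

Lemma geometric_lt_eventually (R : realType) (rho D a : R) : 0 <= rho < 1 -> 0 < a ->
  exists n, forall N, (n <= N)%N -> rho ^+ N * D < a.
Proof.
move=> /andP[r0 r1] a0; have : (fun N => rho ^+ N * D) @ \oo --> 0.
  by rewrite -(mul0r D); apply: cvgMr_tmp; apply: cvg_expr; rewrite ger0_norm.
move=> /cvgr_lt /(_ _ a0) [n _ nP]; exists n => N nN; exact: nP.
Qed.

Section Upper.
Variables (R : realType) (d : nat) (I : countType).
Variables (X : set 'rV[R]_d.+1) (s : I -> 'rV[R]_d.+1 -> 'rV[R]_d.+1).
Variables (lam : I -> 'rV[R]_d.+1 -> R) (rho C D : R).
Hypothesis ms : mobius_system X s lam rho C D.

Local Notation K := (distortion rho C D).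
Local Notation zeta := (zeta X s lam).
Local Notation sup_lam := (sup_lam X s lam).

Lemma word_diam (w : seq I) x y : (word_map s w @` X) x -> (word_map s w @` X) y ->
  enorm (x - y) <= sup_lam w * D.
Proof.
move=> [p Xp <-] [q Xq <-].
apply: le_trans (dist_word_le ms Xp Xq (le_sup_lam ms _ Xp) (le_sup_lam ms _ Xq)) _.
by rewrite ler_wpM2l ?(ltW (sup_lam_gt0 ms _)) // (ms_diam ms).
Qed.

(** The cover consists of the cylinders of length [N], numbered by [pickle]; codes of no word get
    the empty set, which contributes 0 even for t = 0. The cylinder condition in [limit_set] starts
    at length 1, hence the exception for N = 0. *)
Lemma word_cover_sum (t : R) N : 0 <= t ->
  exists U : nat -> set 'rV[R]_d.+1, [/\
    limit_set X s `<=` \bigcup_k U k \/ N = 0%N,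
    forall k, (diam (U k) <= (rho ^+ N * D)%:E)%E &
    (\sum_(0 <= k <oo) diam_pow t (U k) <= (D `^ t)%:E * zeta t N)%E].
Proof.
move=> t0; have D0 := diam_ge0 ms.
pose U k := if @pickle_inv (N.-tuple I) k is Some w then word_map s w @` X else set0.
exists U; split.
- have [->|N0] := posnP N; first by right.
  left => x [om _ omx].
  have tN : size (mkseq om N) == N by rewrite size_mkseq.
  by exists (pickle (Tuple tN)) => //; rewrite /U pickleK_inv; apply: omx.
- move=> k; apply: diam_le => x y; rewrite /U; case: pickle_inv => [w|//] wx wy.
  apply: le_trans (word_diam wx wy) _.
  by rewrite ler_wpM2r // -{2}(size_tuple w) (sup_lam_rho ms).
- rewrite nneseries_esumT; last by move=> k; apply: diam_pow_ge0.
  rewrite (_ : esum _ _ = \esum_(k in range (@pickle (N.-tuple I))) diam_pow t (U k))%E; last first.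
    rewrite [RHS]esum_mkcond; apply: eq_esum => k _; case: ifPn => // /negP kN.
    rewrite /diam_pow asboolT // /U.
    case E : (pickle_inv k) => [w|//]; case: kN; rewrite inE; exists w => //.
    by have := @pickle_invK (N.-tuple I) k; rewrite E.
  rewrite esum_image; last by move=> v w _ _ /(pcan_inj pickleK).
  rewrite -esumZl ?powR_ge0 //; last by move=> w; rewrite lee_fin powR_ge0.
  apply: le_esum => w _; rewrite /U pickleK_inv -EFinM -powRM ?(ltW (sup_lam_gt0 ms _)) //.
  apply: diam_pow_le => //; first by rewrite mulr_ge0 ?(ltW (sup_lam_gt0 ms _)).
  by move=> x y wx wy; rewrite mulrC; apply: word_diam wx wy.
Qed.

Lemma hausdorff_measure_eq0 (t : R) : 0 <= t ->
  (forall e, 0 < e -> forall n, exists2 N, (n <= N)%N & (zeta t N <= e%:E)%E) ->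
  hausdorff_measure t (limit_set X s) = 0%E.
Proof.
move=> t0 small; apply/eqP; rewrite eq_le hausdorff_measure_ge0 andbT.
apply: ge_ereal_sup => _ [delta /= delta0 <-].
apply/lee_addgt0Pr => e e0; rewrite add0e.
have r01 : 0 <= rho < 1 by rewrite (rho_ge0 ms) (rho_lt1 ms).
have [n nP] := geometric_lt_eventually D r01 delta0.
(* The added 1 allows D^t to vanish; below, asking for at least [n.+1] excludes N = 0. *)
have Dt : 0 < D `^ t + 1 by rewrite ltr_wpDl ?powR_ge0.
have [N nN zN] := small _ (divr_gt0 e0 Dt) n.+1.
have [U [cU dU sU]] := word_cover_sum N t0.
apply: (@le_trans _ _ (\sum_(0 <= k <oo) diam_pow t (U k))%E).
  apply: ereal_inf_lbound; exists U => //; split.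
    by case: cU => // N0; move: nN; rewrite N0.
  by move=> k; apply: le_trans (dU k) _; rewrite lee_fin ltW // nP // ltnW.
apply: le_trans sU _; apply: le_trans (lee_wpmul2l _ zN) _; first by rewrite lee_fin powR_ge0.
by rewrite lee_fin mulrCA ger_pMr // ler_pdivrMr // mul1r lerDl.
Qed.

Lemma partition_sum_le (t : R) N : 0 <= t -> (partition_sum X s t N <= zeta t N)%E.
Proof.
move=> t0; apply: le_esum => w _; apply: ge_ereal_sup => _ [x Xx <-].
rewrite lee_fin (dnorm_word ms) // ge0_ler_powR ?nnegrE ?(le_sup_lam ms) //.
- exact/ltW/(lam_word_gt0 ms).
- exact/ltW/(sup_lam_gt0 ms).
Qed.

Lemma partition_sum_ge (t : R) N : 0 <= t ->
  (zeta t N <= (K `^ t)%:E * partition_sum X s t N)%E.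
Proof.
have [x Xx] := ms_nonempty ms.
have H (w : N.-tuple I) : ((lam_word s lam w x `^ t)%:E <=
    ereal_sup [set (dnorm (word_map s w) x `^ t)%:E | x in X])%E.
  by apply: ereal_sup_ubound; exists x; rewrite ?(dnorm_word ms).
move=> t0; rewrite -esumZl ?powR_ge0 //; last first.
  by move=> w; apply: le_trans (H w); rewrite lee_fin powR_ge0.
apply: le_esum => w _; apply: le_trans (lee_wpmul2l _ (H w)); last by rewrite lee_fin powR_ge0.
have K0 : 0 <= K by rewrite expR_ge0.
have l0 := ltW (lam_word_gt0 ms w Xx).
rewrite lee_fin -powRM // ge0_ler_powR ?nnegrE ?mulr_ge0 ?(sup_lam_distort ms) //.
exact/ltW/(sup_lam_gt0 ms).
Qed.

(** The partition sums lie between K^(-t) and [B], so their logarithms are bounded and division by N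
    sends them to 0. *)
Lemma pressure_eq0 (t B : R) : 0 <= t ->
  (forall N, (1 <= zeta t N <= B%:E)%E) -> pressure X s t = 0%E.
Proof.
move=> t0 zB; have K0 : 0 < K `^ t by rewrite powR_gt0 // expR_gt0.
pose p N := fine (partition_sum X s t N).
have psB N : (partition_sum X s t N <= B%:E)%E.
  by apply: le_trans (partition_sum_le _ t0) _; case/andP: (zB N).
have ps_ge N : ((K `^ t)^-1%:E <= partition_sum X s t N)%E.
  have : (1 <= (K `^ t)%:E * partition_sum X s t N)%E.
    by apply: le_trans (partition_sum_ge _ t0); case/andP: (zB N).
  move=> /(lee_wpmul2l (_ : 0 <= (K `^ t)^-1%:E)%E).
  by rewrite mule1 muleA -EFinM mulVf ?gt_eqF // mul1e lee_fin invr_ge0 ltW //; apply.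
have pE N : partition_sum X s t N = (p N)%:E.
  rewrite fineK // ge0_fin_numE; first by apply: le_lt_trans (psB N) (ltry _).
  by apply: le_trans (ps_ge N); rewrite lee_fin invr_ge0 ltW.
have pB N : p N <= B by rewrite -lee_fin -pE.
have p_ge N : (K `^ t)^-1 <= p N by rewrite -lee_fin -pE.
have p0 N : 0 < p N by apply: lt_le_trans (p_ge N); rewrite invr_gt0.
rewrite /pressure (_ : (fun N => _) = EFin \o (fun N => N%:R^-1 * ln (p N))); last first.
  by apply/funext => N /=; rewrite pE lne_EFin.
apply/cvg_lim => //; apply: cvg_EFin; first exact: nearW.
(* After the shift the factor is 1/(N+1), that is [harmonic N]. *)
rewrite -cvg_shiftS /=.
pose M := `|ln (K `^ t)^-1| + `|ln B|.
have lnp N : `|ln (p N)| <= M.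
  have h1 : ln (K `^ t)^-1 <= ln (p N) by rewrite ler_ln ?posrE ?invr_gt0.
  have h2 : ln (p N) <= ln B by rewrite ler_ln ?posrE // (lt_le_trans (p0 N)).
  have n1 := normr_ge0 (ln B); have n2 := normr_ge0 (ln (K `^ t)^-1).
  rewrite ler_norml; apply/andP; split.
    by have := ler_norm (- ln (K `^ t)^-1); rewrite normrN /M; lra.
  by have := ler_norm (ln B); rewrite /M; lra.
have hM : (fun N : nat => M * harmonic N) @ \oo --> 0.
  by rewrite -(mulr0 M); apply: cvgMl_tmp; apply: cvg_harmonic.
apply: (@squeeze_cvgr _ _ _ _ (fun N => - (M * harmonic N)) (fun N => M * harmonic N)) => //.
  apply: nearW => N; rewrite -ler_norml normrM ger0_norm ?invr_ge0 ?ler0n //.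
  by rewrite mulrC ler_wpM2r ?invr_ge0 ?ler0n.
by rewrite -oppr0; apply: cvgN.
Qed.

(** Either all sums at [t] are at least 1, and [critical_exponent] yields a zero of the pressure, or
    one of them is below 1, and its powers bound the sums at multiples of that length, which
    therefore become arbitrarily small. *)
Lemma hausdorff_upper (r t : R) : 0 <= r -> r < t -> (zeta r 1 < +oo)%E ->
  irregular X s -> hausdorff_measure t (limit_set X s) = 0%E.
Proof.
move=> r0 rt fr irr.
have fin u N : r <= u -> zeta u N \is a fin_num.
  by move=> ru; rewrite ge0_fin_numE ?zeta_ge0 // (zeta_fin ms N r0 ru).
have ge0 u : r <= u -> 0 <= u by apply: le_trans.
pose z u N := fine (zeta u N).
have zE u N : r <= u -> zeta u N = (z u N)%:E by move=> ru; rewrite fineK // fin.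
have z_ge0 u N : 0 <= z u N by rewrite fine_ge0 ?zeta_ge0.
have z0 u : z u 0 = 1 by rewrite /z (zeta0 ms).
have lty u N : r <= u -> (zeta u N < +oo)%E by move=> ru; rewrite zE // ltry.
have z_submul u N M : r <= u -> z u (N + M)%N <= z u N * z u M.
  move=> ru; rewrite -lee_fin EFinM -!zE //.
  by apply: (zeta_submul ms); rewrite ?ge0 ?lty.
have z_supmul u N M : r <= u -> z u N * z u M <= K `^ u * z u (N + M)%N.
  move=> ru; rewrite -lee_fin !EFinM -!zE //.
  by apply: (zeta_supmul ms); rewrite ?ge0 ?lty.
have z_decr u v N : r <= u -> u <= v -> z v N <= (rho `^ (v - u)) ^+ N * z u N.
  move=> ru uv; rewrite -lee_fin EFinM -!zE // ?(le_trans ru) //.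
  exact: (zeta_decr ms).
have z_convex u N (e : R) : r <= u -> 0 <= e <= 1 ->
    z ((1 - e) * u + e * r) N <= (1 - e) * z u N + e * z r N.
  move=> ru e01; rewrite -lee_fin EFinD !EFinM -!zE //; first exact: (zeta_convex ms).
  by case/andP: e01 => e0 e1; nra.
have [zt|] := pselect (forall N, 1 <= z t N).
  have [u ru zu] := critical_exponent r0 (distortion_ge1 ms) (ms_rho ms)
    (fun u N _ => z_ge0 u N) (fun u _ => z0 u) z_submul z_supmul z_decr z_convex rt zt.
  case: irr; exists u; first exact/ge0/ltW.
  apply: (@pressure_eq0 _ (K `^ (u + 1))); first exact/ge0/ltW.
  by move=> N; rewrite zE ?(ltW ru) // !lee_fin.
move=> /existsNP[N /negP]; rewrite -ltNge => zN.
have rt' := ltW rt.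
have N0 : (0 < N)%N by rewrite lt0n; apply: contraTneq zN => ->; rewrite z0 ltxx.
apply: hausdorff_measure_eq0 => [|e e0 n]; first exact: ge0.
have zN01 : 0 <= z t N < 1 by rewrite z_ge0.
have [m mP] := geometric_lt_eventually 1 zN01 e0.
exists ((maxn n m) * N)%N.
  by rewrite (leq_trans (leq_maxl n m)) // leq_pmulr.
rewrite zE // lee_fin.
have := z_mulr_le (fun u N _ => z_ge0 u N) (fun u _ => z0 u) z_submul N (maxn n m) rt'.
move=> /le_trans; apply; apply: ltW.
by have := mP (maxn n m); rewrite mulr1; apply; apply: leq_maxr.
Qed.

End Upper.

(** * Lower bound for the Hausdorff measure *)

(** Right continuity of x^t at [a], with the t-th root of a^t + e as witness; t = 0 is apart since
    x^0 = 1 everywhere, 0 included. *)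
Lemma powR_adherent (R : realType) (a t e : R) : 0 <= a -> 0 <= t -> 0 < e ->
  exists2 b, a < b & b `^ t <= a `^ t + e.
Proof.
move=> a0; rewrite le_eqVlt => /predU1P[<-|t0] e0.
  by exists (a + 1); rewrite ?ltrDl // !powRr0 lerDl ltW.
have p0 : 0 <= a `^ t + e by rewrite addr_ge0 ?powR_ge0 // ltW.
exists ((a `^ t + e) `^ t^-1); last by rewrite -powRrM mulVf ?gt_eqF // powRr1.
rewrite -[ltLHS](powRr1 a0) -(divff (lt0r_neq0 t0)) powRrM.
by rewrite gt0_ltr_powR ?invr_gt0 ?nnegrE ?powR_ge0 // ltrDl.
Qed.

(** Hausdorff covers use arbitrary sets, whereas the descent needs sets containing a ball around
    each covered point. The last clause is guarded by nonemptiness because the empty set has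
    [diam_pow] 0 while the first component must stay positive. *)
Lemma open_enlargement (R : realType) (d : nat) (U : set 'rV[R]_d) (t e : R) :
  0 <= t -> 0 < e -> (diam U < +oo)%E ->
  exists aV : R * set 'rV[R]_d, [/\ 0 < aV.1,
    forall x, U x -> exists2 eta, 0 < eta & forall y, enorm (x - y) < eta -> aV.2 y,
    forall x y, aV.2 x -> aV.2 y -> enorm (x - y) <= aV.1 &
    aV.2 !=set0 -> ((aV.1 `^ t)%:E <= diam_pow t U + e%:E)%E].
Proof.
move=> t0 e0 dU; have [->|/set0P[x0 Ux0]] := eqVneq U set0.
  exists (1, set0); split => //=; first by case=> y.
have d_ge x y : U x -> U y -> ((enorm (x - y))%:E <= diam U)%E.
  by move=> Ux Uy; apply: ereal_sup_ubound; exists (x, y).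
have d0 : (0 <= diam U)%E by apply: le_trans (d_ge _ _ Ux0 Ux0); rewrite lee_fin enorm_ge0.
have dE : diam U = (fine (diam U))%:E by rewrite fineK // ge0_fin_numE.
have [b ab bt] := powR_adherent (fine_ge0 d0) t0 e0.
(* Thickening adds at most eta at each of the two endpoints. *)
pose eta := (b - fine (diam U)) / 2.
have eta0 : 0 < eta by rewrite divr_gt0 // subr_gt0.
exists (b, [set y | exists2 x, U x & enorm (x - y) < eta]); split => /=.
- by apply: le_lt_trans ab; apply: fine_ge0.
- by move=> x Ux; exists eta => // y xy; exists x.
- move=> x y [x' Ux' xx'] [y' Uy' yy'].
  have := ler_enormB_add x x' y; have := ler_enormB_add x' y' y.
  have := d_ge _ _ Ux' Uy'; rewrite dE lee_fin.
  by move: xx' yy'; rewrite [enorm (x' - x)]enormC /eta; lra.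
- move=> _; rewrite /diam_pow asboolF; last by move=> U0; rewrite U0 in Ux0.
  by rewrite dE poweR_EFin -EFinD lee_fin.
Qed.

Lemma nneseries_ge_term (R : realType) (f : nat -> \bar R) k :
  (forall n, 0 <= f n)%E -> (f k <= \sum_(0 <= n <oo) f n)%E.
Proof.
move=> f0; apply: le_trans (nneseries_lim_ge k.+1 _); last by move=> n _ _; apply: f0.
by rewrite big_nat_recr //= leeDr // sume_ge0.
Qed.

Section Lower.
Variables (R : realType) (d : nat) (I : countType).
Variables (X : set 'rV[R]_d.+1) (s : I -> 'rV[R]_d.+1 -> 'rV[R]_d.+1).
Variables (lam : I -> 'rV[R]_d.+1 -> R) (rho C D : R).
Hypothesis ms : mobius_system X s lam rho C D.
Variables (M : nat) (phi : 'I_M.+2 -> I) (c : 'I_M.+2 -> R) (delta t : R).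
Hypothesis t0 : 0 <= t.
Hypothesis delta0 : 0 < delta.
Hypothesis c0 : forall i, 0 < c i.
Hypothesis c_lip : forall i x y, X x -> X y ->
  c i * enorm (x - y) <= enorm (s (phi i) x - s (phi i) y).
Hypothesis sep : forall i j x y, i != j -> X x -> X y ->
  delta <= enorm (s (phi i) x - s (phi j) y).
Hypothesis c_sum : 1 <= \sum_i c i `^ t.
Implicit Types (w : seq 'I_M.+2).

Let cw w := \prod_(i <- w) c i.

Let cw_gt0 w : 0 < cw w.
Proof. by apply: prodr_gt0. Qed.

Let word w := word_map s (map phi w).

Let word_lip w x y : X x -> X y -> cw w * enorm (x - y) <= enorm (word w x - word w y).
Proof.
move=> Xx Xy; elim: w => [|i w IH]; first by rewrite /cw big_nil mul1r.
rewrite /cw big_cons -mulrA.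
apply: le_trans (ler_wpM2l (ltW (c0 i)) IH) _.
by apply: c_lip; apply: (word_map_stable ms).
Qed.

Section Descent.
Variables (a : nat -> R) (V : nat -> set 'rV[R]_d.+1).
Hypothesis a0 : forall k, 0 < a k.
Hypothesis Va : forall k x y, V k x -> V k y -> enorm (x - y) <= a k.

Let hit k w := `[< V k `&` (word w @` X) !=set0 >].

(** The t-sum of the cover seen from the cylinder of [w]: only sets meeting it count, with sizes
    divided by its lower contraction ratio. *)
Let S w : \bar R :=
  (\sum_(0 <= k <oo) if hit k w then ((a k / cw w) `^ t)%:E else 0)%E.

Let term_ge0 k w : (0 <= if hit k w then ((a k / cw w) `^ t)%:E else 0)%E.
Proof. by case: ifP => // _; rewrite lee_fin powR_ge0. Qed.

Let hit_rcons k w i : hit k (rcons w i) -> hit k w.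
Proof.
move=> /asboolP[y [Vy [x Xx xy]]]; apply/asboolP; exists y; split=> //.
exists (s (phi i) x); first exact: (ms_stable ms).
by rewrite -xy /word map_rcons word_map_rcons.
Qed.

(** A set meeting two subcylinders of [w] has size at least delta * cw w by separation, so its
    single term would already be delta^t. *)
Let hit_unique k w i j : (S w < (delta `^ t)%:E)%E ->
  hit k (rcons w i) -> hit k (rcons w j) -> i = j.
Proof.
move=> Sw hi hj; apply/eqP/negPn/negP => ij; move: (hi) (hj).
move=> /asboolP[u [Vu [p Xp pu]]] /asboolP[v [Vv [q Xq qv]]].
have : (((a k / cw w) `^ t)%:E <= S w)%E.
  apply: le_trans (nneseries_ge_term k (term_ge0^~ w)).
  by rewrite (hit_rcons hi).
move=> /le_lt_trans/(_ Sw); rewrite lte_fin ltNge => /negP; apply.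
have cwd : delta <= a k / cw w.
  rewrite ler_pdivlMr ?cw_gt0 // mulrC; apply: le_trans (Va Vu Vv).
  rewrite -pu -qv /word !map_rcons !word_map_rcons.
  apply: le_trans (word_lip w (ms_stable ms _ Xp) (ms_stable ms _ Xq)).
  by rewrite ler_wpM2l ?(ltW (cw_gt0 _)) // sep.
by rewrite ge0_ler_powR ?nnegrE ?(ltW delta0) // divr_ge0 // ltW.
Qed.

(** The rescaling gives c_i^t (a / cw (wi))^t = (a / cw w)^t, and each set hits at most one child,
    so the sum of c_i^t S(wi) is at most S(w); not all S(wi) can reach delta^t. *)
Let S_step w : (S w < (delta `^ t)%:E)%E -> exists i, (S (rcons w i) < (delta `^ t)%:E)%E.
Proof.
move=> Sw; apply/not_existsP => H.
have {}H i : ((delta `^ t)%:E <= S (rcons w i))%E by rewrite leNgt; apply/negP.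
move: (Sw); apply/negP; rewrite -leNgt.
apply: (@le_trans _ _ (\sum_(i < M.+2) (c i `^ t)%:E * S (rcons w i))%E).
  apply: (@le_trans _ _ (\sum_(i < M.+2) (c i `^ t)%:E * (delta `^ t)%:E)%E).
    under eq_bigr do rewrite -EFinM.
    by rewrite sumEFin lee_fin -mulr_suml ler_peMl ?powR_ge0.
  by apply: lee_sum => i _; apply: lee_wpmul2l (H i); rewrite lee_fin powR_ge0.
under eq_bigr => i _ do rewrite /S -nneseriesZl ?lee_fin ?powR_ge0 //.
rewrite -nneseries_sum; last first.
  by move=> i k _; apply: mule_ge0 (term_ge0 _ _); rewrite lee_fin powR_ge0.
apply: lee_nneseries => k _.
  by move=> _; apply: sume_ge0 => i _; apply: mule_ge0 (term_ge0 _ _); rewrite lee_fin powR_ge0.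
have cE i : ((c i `^ t)%:E * ((a k / cw (rcons w i)) `^ t)%:E = ((a k / cw w) `^ t)%:E)%E.
  rewrite -EFinM -powRM; [|exact: ltW|by rewrite divr_ge0 // ltW].
  by rewrite /cw big_rcons /= -/(cw w); congr (_ `^ _)%:E; field; rewrite !gt_eqF.
have [[i hi]|no] := pselect (exists i, hit k (rcons w i)).
  rewrite (bigD1 i) //= hi cE (hit_rcons hi) big1 ?adde0 // => j ji.
  case: ifP => hj; last by rewrite mule0.
  by move: ji; rewrite (hit_unique Sw hi hj) eqxx.
rewrite big1 // => i _; case: ifP => hi; last by rewrite mule0.
by case: no; exists i.
Qed.

(* Since sum c_i^t >= 1 and no V k meets two of the sets word (rcons w i) @` X,
   the bound S w < delta^t passes to one of the rcons w i.  A neighbourhood of the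
   point coded by the resulting infinite word would contain a whole cylinder,
   hence meet two of these sets. *)
Lemma descent :
  (\sum_(0 <= k <oo) (if `[< V k !=set0 >] then (a k `^ t)%:E else 0) < (delta `^ t)%:E)%E ->
  exists2 x, limit_set X s x &
    forall k eta, 0 < eta -> exists2 y, enorm (x - y) < eta & ~ V k y.
Proof.
move=> Snil; have {Snil}S0 : (S [::] < (delta `^ t)%:E)%E.
  apply: le_lt_trans Snil; apply: lee_nneseries => k _; first by move=> _; exact: term_ge0.
  rewrite /cw big_nil divr1; case: ifP => [/asboolP[y [Vy _]]|_]; last first.
    by case: ifP => // _; rewrite lee_fin powR_ge0.
  by rewrite asboolT //; exists y.
pose next w := xget ord0 [set i | (S (rcons w i) < (delta `^ t)%:E)%E].
pose W := fix W n := if n is n'.+1 then rcons (W n') (next (W n')) else [::].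
pose om n := next (W n).
have omW n : mkseq om n = W n by elim: n => //= n IH; rewrite mkseqS IH.
have SW n : (S (W n) < (delta `^ t)%:E)%E.
  elim: n => [//|n IH]; have [i Si] := S_step IH.
  by rewrite /= /next; case: xgetP => [j -> //|/(_ i)].
have [x xom] := word_limit_point (ms) (phi \o om).
exists x; first by exists (phi \o om) => // N _; apply: xom.
move=> k eta eta0; apply: contrapT => nV.
have {}nV y : enorm (x - y) < eta -> V k y.
  by move=> xy; apply: contrapT => Vy; apply: nV; exists y.
have r01 : 0 <= rho < 1 by rewrite (rho_ge0 ms) (rho_lt1 ms).
have [N NP] := geometric_lt_eventually D r01 eta0.
have [x0 Xx0] := ms_nonempty ms.
have hitN i : hit k (rcons (W N) i).
  apply/asboolP; exists (word (rcons (W N) i) x0); split; last by exists x0.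
  apply: nV; have [q Xq <-] := xom N.
  have -> : mkseq (phi \o om) N = map phi (W N) by rewrite -omW /mkseq map_comp.
  rewrite /word map_rcons word_map_rcons.
  apply: le_lt_trans (word_contract ms _ Xq (ms_stable ms _ Xx0)) _.
  by apply: NP; rewrite size_map -omW size_mkseq.
(* The index type ['I_M.+2] makes [ord0] and [ord_max] distinct. *)
by have /(congr1 val) := hit_unique (SW N) (hitN ord0) (hitN ord_max).
Qed.

End Descent.

(** A cover of t-sum below delta^t/2 is thickened, the k-th set at cost delta^t/2^(k+2), into one of
    t-sum below delta^t; [descent] then gives a limit point no neighbourhood of which lies in a
    thickened set. *)
Lemma hausdorff_lower : hausdorff_measure t (limit_set X s) <> 0%E.
Proof.
move=> H0; have e0 : 0 < delta `^ t / 2 by rewrite divr_gt0 // powR_gt0.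
(* Scale 1 serves only to make the diameters finite. *)
have : (hausdorff_premeasure t 1 (limit_set X s) < (delta `^ t / 2)%:E)%E.
  apply: le_lt_trans (_ : 0 < _)%E; last by rewrite lte_fin.
  by rewrite -H0; apply: ereal_sup_ubound; exists 1 => //=.
move=> /ereal_inf_lt[_ [U [cU dU] <-] sU].
have fat k : exists aV : R * set 'rV[R]_d.+1, [/\ 0 < aV.1,
    forall x, U k x -> exists2 eta, 0 < eta & forall y, enorm (x - y) < eta -> aV.2 y,
    forall x y, aV.2 x -> aV.2 y -> enorm (x - y) <= aV.1 &
    aV.2 !=set0 -> ((aV.1 `^ t)%:E <=
      diam_pow t (U k) + (delta `^ t / 2 / (2 ^ k.+1)%:R)%:E)%E].
  apply: open_enlargement => //; first by rewrite divr_gt0 // ltr0n expn_gt0.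
  by apply: le_lt_trans (dU k) (ltry _).
have /choice[aV /all_and4[a0 UV Va aV_le]] := fat.
have sumV : (\sum_(0 <= k <oo) (if `[< (aV k).2 !=set0 >] then ((aV k).1 `^ t)%:E else 0)
    < (delta `^ t)%:E)%E.
  apply: (@le_lt_trans _ _ (\sum_(0 <= k <oo) (diam_pow t (U k) +
      (delta `^ t / 2 / (2 ^ k.+1)%:R)%:E))%E).
    apply: lee_nneseries => k _; first by move=> _; case: ifP => // _; rewrite lee_fin powR_ge0.
    case: ifP => [/asboolP|_]; first exact: aV_le.
    by rewrite adde_ge0 ?diam_pow_ge0 // lee_fin divr_ge0 // ltW.
  apply: le_lt_trans (epsilon_trick _ _ _) _.
  - by move=> k; apply: diam_pow_ge0.
  - exact: ltW.
  by rewrite [in ltRHS](splitr (delta `^ t)) EFinD lteD2rE.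
have [x Jx xV] := descent a0 Va sumV.
have [k _ Ukx] := cU _ Jx.
have [eta eta0 etaV] := UV _ _ Ukx.
by have [y xy] := xV k _ eta0; apply; apply: etaV.
Qed.

End Lower.

(** * The two systems of the theorem *)

Lemma admissible_ge (R : realType) (d : nat -> R) n m :
  admissible d -> (n <= m)%N -> d n + 2 * (m - n)%:R <= d m.
Proof.
move=> [_ dS] /subnKC <-; rewrite addKn; elim: (m - n)%N => [|k IH].
  by rewrite mulr0 addr0 addn0.
by rewrite addnS; have := dS (n + k)%N; rewrite -[k.+1%:R]natr1 mulrDr; lra.
Qed.

Lemma admissible_ge2 (R : realType) (d : nat -> R) n : admissible d -> 2 <= d n.
Proof.
move=> hd; have := admissible_ge hd (leq0n n); have : (0 : R) <= (n - 0)%:R by [].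
by case: hd; lra.
Qed.

Section Comparison.
Variables (R : realType) (d : nat -> R) (T : nat) (j0 : 'I_T).
Variables (X : set 'rV[R]_2) (s : nat * 'I_T -> 'rV[R]_2 -> 'rV[R]_2).
Variables (lam : nat * 'I_T -> 'rV[R]_2 -> R) (rho C D : R).
Hypothesis hd : admissible d.
Hypothesis ms : mobius_system X s lam rho C D.
Hypothesis lam_bounds : forall i x, X x -> (d i.1 ^+ 2)^-1 / 4 <= lam i x <= 4 * (d i.1 ^+ 2)^-1.
Hypothesis coord_bounds : forall n x, X x ->
  (d n + 1)^-1 <= s (n, j0) x 0 0 <= (d n - 1)^-1.

(* The images of consecutive maps may touch, those of even indices are separated. *)
Definition even_sum_bounded (r : R) : Prop :=
  exists B, forall N, \sum_(0 <= k < N) (d k.*2 ^+ 2)^-1 `^ r <= B.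

Let d_gt0 n : 0 < d n.
Proof. by apply: lt_le_trans (admissible_ge2 n hd); rewrite ltr0n. Qed.

Let u n := (d n ^+ 2)^-1.

Let u_gt0 n : 0 < u n.
Proof. by rewrite invr_gt0 exprn_gt0. Qed.

(** Odd terms are dominated by the preceding even ones since [d] increases, which doubles the sum;
    the rotations multiply it by a finite constant. *)
Lemma zeta1_lty (r : R) : 0 <= r -> even_sum_bounded r -> (zeta X s lam r 1 < +oo)%E.
Proof.
move=> r0 [B sB].
pose f n := (4 * u n) `^ r.
have f0 n : (0 <= (f n)%:E)%E by rewrite lee_fin powR_ge0.
rewrite /zeta (reindex_esum [set: nat * 'I_T] _ (fun i => [tuple i])); last first.
  split => // [i j _ _ /(congr1 val) []//|w _].
  exists (thead w) => //; apply: val_inj.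
  by case: w => -[|i []].
apply: (@le_lt_trans _ _ (\esum_(i in [set: nat * 'I_T]) (f i.1)%:E)%E).
  apply: le_esum => i _; rewrite lee_fin ge0_ler_powR ?nnegrE //.
  - exact/ltW/(sup_lam_gt0 ms).
  - by rewrite mulr_ge0 // ltW.
  - by apply: (sup_lam_le ms) => x Xx /=; rewrite mulr1; case/andP: (lam_bounds i Xx).
rewrite (_ : setT = [set: nat] `*`` (fun=> [set: 'I_T])); last by apply/seteqP; split=> -[].
rewrite -(esum_esum (a := fun n j => (f n)%:E)) //.
pose c : R := (size (finmap.enum_fset (fset_set [set: 'I_T])))%:R.
under eq_esum => n _.
  rewrite esum_fset; [|exact: finite_finset|by move=> j _; apply: f0].
  rewrite fsbig_finite ?sumEFin; last exact: finite_finset.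
  rewrite big_const_seq count_predT iter_addr_0 -mulr_natl -/c EFinM.
  over.
rewrite esumZl ?ler0n // -nneseries_esumT //.
apply: (@le_lt_trans _ _ (c%:E * (4 `^ r * B *+ 2)%:E)%E); last by rewrite -EFinM ltry.
rewrite lee_wpmul2l ?lee_fin ?ler0n //.
apply: lime_le; first by apply: is_cvg_nneseries.
apply: nearW => N; rewrite sumEFin lee_fin.
have fu n : f n = 4 `^ r * u n `^ r by rewrite /f powRM ?(ltW (u_gt0 _)).
have u_decr k : u k.*2.+1 <= u k.*2.
  have := hd.2 k.*2; rewrite /u lef_pV2 ?posrE ?exprn_gt0 // => dk.
  by rewrite lerXn2r ?nnegrE ?(ltW (d_gt0 _)) //; lra.
apply: (@le_trans _ _ (\sum_(0 <= n < N.*2) f n)).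
  rewrite [leRHS](@big_cat_nat _ _ _ N) //=; last by rewrite -addnn leq_addr.
  by rewrite lerDl sumr_ge0 // => n _; rewrite powR_ge0.
apply: (@le_trans _ _ (\sum_(0 <= k < N) 4 `^ r * u k.*2 `^ r *+ 2)).
  elim: N => [|N IH]; first by rewrite !big_nil.
  rewrite doubleS !big_nat_recr //= -addrA lerD // mulr2n !fu lerD2l ler_wpM2l ?powR_ge0 //.
  by rewrite ge0_ler_powR ?nnegrE ?(ltW (u_gt0 _)).
by rewrite sumrMnl -mulr_sumr lerMn2r /= ler_wpM2l ?powR_ge0 // sB.
Qed.

(** If an even partial sum exceeded 4^r, the lower ratios c_i = u/4 would satisfy sum c_i^r >= 1 and
    [hausdorff_lower] would apply. Two more indices than the partial sum has are kept, so that there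
    are at least two maps. *)
Lemma hausdorff_eq0_even_sum (r : R) : 0 <= r ->
  hausdorff_measure r (limit_set X s) = 0%E -> even_sum_bounded r.
Proof.
move=> r0 H0; exists (4 `^ r) => M; rewrite leNgt; apply/negP => sM.
pose P := M.+1.*2.
pose phi (i : 'I_M.+2) : nat * 'I_T := (i.*2, j0).
pose c (i : 'I_M.+2) : R := u i.*2 / 4.
(* For parameters A < B two even steps of [d] or more apart, B - A >= 4 and the strips of the images
   are (B - A - 2) / ((A + 1)(B - 1)) apart, where both factors are at most d P + 1 since [P] is the
   largest selected index. *)
pose delta : R := 2 / (d P + 1) ^+ 2.
have dP1 : 0 < d P + 1 by rewrite addr_gt0.
have c0 i : 0 < c i by rewrite divr_gt0.
have delta0 : 0 < delta by rewrite divr_gt0 // exprn_gt0.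
have c_lip i x y : X x -> X y ->
    c i * enorm (x - y) <= enorm (s (phi i) x - s (phi i) y).
  move=> Xx Xy; have ci := ltW (c0 i).
  have ce : 0 <= c i * enorm (x - y) by apply: mulr_ge0 => //; apply: enorm_ge0.
  rewrite -(@ler_pXn2r _ 2) ?nnegrE ?enorm_ge0 //.
  rewrite exprMn !sqr_enorm (ms_dist ms) // mulrC ler_wpM2l ?dotp_ge0 //.
  have /andP[lx _] := lam_bounds (phi i) Xx; have /andP[ly _] := lam_bounds (phi i) Xy.
  by rewrite expr2; apply: ler_pM.
have coord_le (v : 'rV[R]_2) : v 0 0 <= enorm v.
  apply: le_trans (ler_norm _) _.
  rewrite -(@ler_pXn2r _ 2) ?nnegrE ?enorm_ge0 // real_normK ?num_real // sqr_enorm.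
  by rewrite /dotp (bigD1 ord0) //= -expr2 lerDl sumr_ge0 // => k _; rewrite -expr2 sqr_ge0.
have sep_lt : forall (i j : 'I_M.+2) x y, (i < j)%N -> X x -> X y ->
    delta <= enorm (s (phi i) x - s (phi j) y).
  move=> i j x y ij Xx Xy; apply: le_trans (coord_le _); rewrite !mxE.
  have /andP[lx _] := coord_bounds i.*2 Xx; have /andP[_ ly] := coord_bounds j.*2 Xy.
  apply: le_trans (lerB lx ly).
  have ij2 : (i.*2.+2 <= j.*2)%N by rewrite -doubleS leq_double.
  have d1 : d i.*2 + 4 <= d j.*2.
    have := admissible_ge hd ij2; have := hd.2 i.*2; have := hd.2 i.*2.+1.
    have : (0 : R) <= (j.*2 - i.*2.+2)%:R by [].
    by lra.
  have d2 : d j.*2 <= d P.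
    have jP : (j.*2 <= P)%N by rewrite leq_double -ltnS.
    have := admissible_ge hd jP; have : (0 : R) <= (P - j.*2)%:R by [].
    by lra.
  have di := admissible_ge2 i.*2 hd.
  set A := d i.*2 in di d1 *; set B := d j.*2 in d1 d2 *.
  have A1 : 0 < A + 1 by lra.
  have B1 : 0 < B - 1 by lra.
  have -> : (A + 1)^-1 - (B - 1)^-1 = (B - A - 2) / ((A + 1) * (B - 1)).
    by field; rewrite !gt_eqF.
  rewrite /delta ler_pM ?invr_ge0 ?exprn_ge0 ?(ltW dP1) //; first by lra.
  rewrite lef_pV2 ?posrE ?mulr_gt0 ?exprn_gt0 // expr2 ler_pM //; lra.
have sep : forall (i j : 'I_M.+2) x y, i != j -> X x -> X y ->
    delta <= enorm (s (phi i) x - s (phi j) y).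
  move=> i j x y; rewrite neq_ltn => /orP[ij|ji] Xx Xy; first exact: sep_lt.
  by rewrite enormC; apply: sep_lt.
have c_sum : 1 <= \sum_i c i `^ r.
  have -> : \sum_i c i `^ r = (\sum_(0 <= k < M.+2) u k.*2 `^ r) * (4 `^ r)^-1.
    rewrite big_mkord mulr_suml; apply: eq_bigr => i _.
    rewrite /c powRM; [|exact: ltW|by rewrite invr_ge0].
    by rewrite -powRN -powR_inv1 // -powRrM mulN1r.
  rewrite ler_pdivlMr ?powR_gt0 // mul1r; apply: le_trans (ltW sM) _.
  rewrite [leRHS](@big_cat_nat _ _ _ M) //=; last by rewrite leqW.
  by rewrite lerDl sumr_ge0 // => k _; rewrite powR_ge0.
exact: (hausdorff_lower ms r0 delta0 c0 c_lip sep c_sum).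
Qed.

Lemma hausdorff_eq0_irregular (r t : R) : 0 <= r -> r < t -> even_sum_bounded r ->
  irregular X s -> hausdorff_measure t (limit_set X s) = 0%E.
Proof. by move=> r0 rt br; apply: (hausdorff_upper ms r0 rt (zeta1_lty r0 br)). Qed.

End Comparison.

(** * Conformality read off a distance identity *)

Lemma differentiable_dotp (R : realType) (n : nat) (x : 'rV[R]_n) :
  differentiable (fun u : 'rV[R]_n => dotp u u) x.
Proof.
rewrite (_ : (fun u => _) = \sum_(k < n) (fun u : 'rV[R]_n => u 0 k * u 0 k)); last first.
  by apply/funext => u; rewrite fct_sumE.
by apply: differentiable_sum => k; apply: differentiableM; apply: differentiable_coord.
Qed.

(** The identity fixes the norm of each difference quotient along t v; letting t tend to 0 gives
    that of the differential, whose matrix is never computed. *)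
Lemma conformal_of_dist (R : realType) (m n : nat) (h : 'rV[R]_m.+1 -> 'rV[R]_n.+1)
    (l : 'rV[R]_m.+1 -> R) (x v : 'rV[R]_m.+1) :
  differentiable h x -> {for x, continuous l} -> 0 <= l x ->
  (\forall y \near x, dotp (h y - h x) (h y - h x) = dotp (y - x) (y - x) * (l y * l x)) ->
  enorm ('d h x v) = l x * enorm v.
Proof.
move=> dh cl lx hl.
have cdot (p : nat) : continuous (fun u : 'rV[R]_p.+1 => dotp u u).
  by move=> u; apply/differentiable_continuous/differentiable_dotp.
pose q (t : R) := t^-1 *: ((h \o shift x) (t *: v) - h x).
have qL : q @ 0^' --> 'd h x v.
  have := @diff_derivable _ _ _ h x v dh; rewrite /derivable => /cvg_ex[L qL].
  by rewrite -deriveE // /derive (cvg_lim _ qL).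
have c1 : (fun t => dotp (q t) (q t)) @ 0^' --> dotp ('d h x v) ('d h x v).
  exact: (cvg_comp _ _ qL (@cdot _ _)).
have tv : (fun t : R => t *: v + x) @ 0^' --> x.
  have : (fun t : R => t *: v + x) @ (0 : R) --> (0 : R) *: v + x.
    by apply: cvgD; [apply: scalel_continuous|apply: cvg_cst].
  by rewrite scale0r add0r; apply: cvg_within_filter.
have c2 : (fun t : R => dotp v v * (l (t *: v + x) * l x)) @ 0^' --> dotp v v * (l x * l x).
  apply: cvgM; first exact: cvg_cst.
  by apply: cvgM; [apply: (cvg_comp _ _ tv cl)|apply: cvg_cst].
have e : \forall t \near 0^', dotp (q t) (q t) = dotp v v * (l (t *: v + x) * l x).
  have nt : \forall t \near (0 : R)^', t != 0 by apply: nbhs_dnbhs_neq.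
  near=> t.
  have t0 : t != 0 by near: t.
  have ht : dotp (h (t *: v + x) - h x) (h (t *: v + x) - h x)
     = dotp (t *: v + x - x) (t *: v + x - x) * (l (t *: v + x) * l x).
    by near: t; exact: (tv _ hl).
  rewrite /q /= dotpZl dotpC dotpZl ht addrK dotpZl dotpC dotpZl; field.
  by rewrite t0.
have dE : dotp ('d h x v) ('d h x v) = dotp v v * (l x * l x).
  apply: (cvg_unique _ c1) => //.
  by apply: cvg_trans c2; apply: near_eq_cvg; apply: filterS e => t ->.
apply/eqP; rewrite -(@eqrXn2 _ 2) ?mulr_ge0 ?enorm_ge0 // exprMn !sqr_enorm dE.
by rewrite mulrC expr2.
Unshelve. all: by end_near. Qed.

(** * The maps in real coordinates *)

Section Plane.
Variable R : realType.
Implicit Types u v w : 'rV[R]_2.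

Lemma dotp2 u v : dotp u v = u 0 0 * v 0 0 + u 0 1 * v 0 1.
Proof.
have o1 : lift ord0 ord0 = 1 :> 'I_2 by apply: val_inj.
by rewrite /dotp !big_ord_recl big_ord0 addr0 o1.
Qed.

Lemma rV2P u v : u 0 0 = v 0 0 -> u 0 1 = v 0 1 -> u = v.
Proof.
move=> h0 h1; apply/rowP => k.
have [->//|k0] := eqVneq k 0.
suff -> : k = 1 by [].
by apply: val_inj; case: k k0 => -[|[|k]].
Qed.

Lemma closed_discE v : closed_disc R v <-> dotp v v <= 1.
Proof. by rewrite -sqr_enorm expr_le1 ?enorm_ge0. Qed.

Lemma closed_disc_diam u v : closed_disc R u -> closed_disc R v -> enorm (u - v) <= 2.
Proof.
rewrite /closed_disc /= => u1 v1.
by have := ler_enormD u (- v); rewrite enormN; lra.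
Qed.

Definition conj_rv u : 'rV[R]_2 := \row_k (if k == 0 then u 0 0 else - u 0 1).

Lemma dotp_conj_rv u : dotp (conj_rv u) (conj_rv u) = dotp u u.
Proof. by rewrite !dotp2 !mxE /=; ring. Qed.

Lemma enorm_conj_rv u : enorm (conj_rv u) = enorm u.
Proof. by rewrite /enorm dotp_conj_rv. Qed.

Variables (d : nat -> R) (T : nat).
Hypothesis hd : admissible d.

Definition param_vec (i : nat * 'I_T) : 'rV[R]_2 := ofC (param d i).

Lemma param_vecE i : param_vec i 0 0 = cos (2 * pi * ((i.2 : nat)%:R / T%:R)) * d i.1 /\
  param_vec i 0 1 = sin (2 * pi * ((i.2 : nat)%:R / T%:R)) * d i.1.
Proof. by rewrite !mxE /param /expi /=; split; ring. Qed.

Lemma dotp_param_vec i : dotp (param_vec i) (param_vec i) = d i.1 ^+ 2.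
Proof.
have [c0 c1] := param_vecE i; rewrite dotp2 c0 c1.
have := cos2Dsin2 (2 * pi * ((i.2 : nat)%:R / T%:R) : R).
set c := cos _; set s := sin _ => cs.
by rewrite -[RHS]mul1r -cs; ring.
Qed.

Lemma d_ge2 n : 2 <= d n.
Proof. exact: admissible_ge2. Qed.

Lemma enorm_param_vec i : enorm (param_vec i) = d i.1.
Proof.
by rewrite /enorm dotp_param_vec sqrtr_sqr ger0_norm //; have := d_ge2 i.1; lra.
Qed.

Lemma enorm_shift i v : closed_disc R v -> d i.1 - 1 <= enorm (v + param_vec i) <= d i.1 + 1.
Proof.
rewrite /closed_disc /= => v1.
have := ler_enormD v (param_vec i); have := ler_enormD (v + param_vec i) (- v).
by rewrite enormN addrAC subrr add0r enorm_param_vec; lra.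
Qed.

Lemma dotp_shift i v : closed_disc R v ->
  (d i.1 - 1) ^+ 2 <= dotp (v + param_vec i) (v + param_vec i) <= (d i.1 + 1) ^+ 2.
Proof.
move=> /(enorm_shift i) /andP[lo hi]; have d2 := d_ge2 i.1.
by rewrite -sqr_enorm !ler_pXn2r ?nnegrE ?enorm_ge0 ?lo ?hi //; lra.
Qed.

Lemma FsysE i v : Fsys d i v = (d i.1 ^+ 2 - 1)^-1 *: (v + conj_rv (param_vec i)).
Proof.
have : `|param d i| ^+ 2 = (d i.1 ^+ 2)%:C%C.
  rewrite sqr_normc -dotp_param_vec dotp2 !mxE; case: (param d i) => p q /=.
  by apply/eqP; rewrite eq_complex /=; apply/andP; split; apply/eqP; ring.
rewrite /Fsys /f_map => ->.
have d2 := d_ge2 i.1.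
have d0 : d i.1 ^+ 2 - 1 != 0 by rewrite gt_eqF //; nra.
apply: rV2P; rewrite ?mxE /param_vec ?mxE; case: (param d i) => p q /=; field.
all: rewrite ?oppr0 ?addr0 ?expr0n /= ?addr0 ?sqrf_eq0 ?d0 //.
Qed.

(** The inverse of w is its conjugate divided by |w|^2. *)
Lemma GsysE i v : Gsys d i v =
  (dotp (v + param_vec i) (v + param_vec i))^-1 *: conj_rv (v + param_vec i).
Proof.
rewrite /Gsys /g_map; apply: rV2P;
  rewrite dotp2 ?mxE /param_vec ?mxE; case: (param d i) => p q /=.
  by rewrite mulrC !expr2.
by rewrite !expr2 mulrN [in RHS]mulrC.
Qed.

End Plane.

Section Systems.
Variables (R : realType) (d : nat -> R) (T : nat).
Hypothesis hd : admissible d.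
Implicit Types (i : nat * 'I_T) (u v x y : 'rV[R]_2).

Let d2 n : 2 <= d n := d_ge2 hd n.

Lemma closed_disc0 : closed_disc R 0.
Proof. by rewrite /closed_disc /= enorm0. Qed.

Definition lamF i x : R := (d i.1 ^+ 2 - 1)^-1.

Definition lamG i x : R := (dotp (x + param_vec d i) (x + param_vec d i))^-1.

Let dsq_gt0 n : 0 < d n ^+ 2 - 1.
Proof. by have := d2 n; nra. Qed.

Lemma Fsys_dist i x y :
  dotp (Fsys d i x - Fsys d i y) (Fsys d i x - Fsys d i y) =
  dotp (x - y) (x - y) * (lamF i x * lamF i y).
Proof.
rewrite !(FsysE hd) -scalerBr opprD addrACA subrr addr0 dotpZl dotpC dotpZl /lamF.
by rewrite mulrA mulrC.
Qed.

(** 1/u - 1/v = (v - u)/(uv), with u and v the shifted points. *)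
Lemma Gsys_dist i x y :
  dotp (x + param_vec d i) (x + param_vec d i) != 0 ->
  dotp (y + param_vec d i) (y + param_vec d i) != 0 ->
  dotp (Gsys d i x - Gsys d i y) (Gsys d i x - Gsys d i y) =
  dotp (x - y) (x - y) * (lamG i x * lamG i y).
Proof.
rewrite !GsysE /lamG => x0 y0.
have -> : x - y = (x + param_vec d i) - (y + param_vec d i) by rewrite opprD addrACA subrr addr0.
move: x0 y0; move: (x + param_vec d i) (y + param_vec d i) => u v.
rewrite !dotp2 !mxE /= => u0 v0; field.
by rewrite u0 v0.
Qed.

Lemma differentiable_Fsys i x : differentiable (Fsys d i) x.
Proof.
rewrite (_ : Fsys d i = (d i.1 ^+ 2 - 1)^-1 *: (id + cst (conj_rv (param_vec d i)))); last first.
  by apply/funext => v; rewrite (FsysE hd).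
by apply: differentiableZ; apply: differentiableD; [apply: ex_diff|apply: differentiable_cst].
Qed.

Lemma differentiable_shift (c x : 'rV[R]_2) :
  differentiable (fun v => dotp (v + c) (v + c)) x.
Proof.
apply: (@differentiable_comp _ _ _ _ (fun v => v + c) (fun u => dotp u u)).
  by apply: differentiableD; [apply: ex_diff|apply: differentiable_cst].
exact: differentiable_dotp.
Qed.

Lemma differentiable_lamG i x :
  dotp (x + param_vec d i) (x + param_vec d i) != 0 -> differentiable (lamG i) x.
Proof. by move=> x0; apply: differentiableV => //; apply: differentiable_shift. Qed.

Lemma differentiable_Gsys i x :
  dotp (x + param_vec d i) (x + param_vec d i) != 0 -> differentiable (Gsys d i) x.
Proof.
move=> x0; rewrite (_ : Gsys d i =
   (fun v => (lamG i v * (v 0 0 + param_vec d i 0 0)) *: delta_mx 0 0) +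
   (fun v => (lamG i v * (- (v 0 1 + param_vec d i 0 1))) *: delta_mx 0 1)); last first.
  by apply/funext => v; rewrite GsysE; apply: rV2P; rewrite !mxE /= /lamG; ring.
apply: differentiableD; apply: differentiableZl; apply: differentiableM.
- exact: differentiable_lamG.
- by apply: differentiableD; [apply: differentiable_coord|apply: differentiable_cst].
- exact: differentiable_lamG.
- by apply: differentiableN; apply: differentiableD; [apply: differentiable_coord|apply: differentiable_cst].
Qed.

(** The ratio 1/3 comes from d^2 - 1 >= 3, the distortion exponent is 0 because the factor is
    constant, and 2 is the diameter of the disc. *)
Lemma Fsys_mobius : compact (closed_disc R) ->
  mobius_system (closed_disc R) (Fsys d (T := T)) lamF 3^-1 0 2.
Proof.
have lam0 i x : 0 < lamF i x by rewrite invr_gt0.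
move=> comp; split => //.
- by exists 0; apply: closed_disc0.
- exact: closed_disc_diam.
- move=> i x; rewrite /closed_disc /= (FsysE hd) enormZ => x1.
  rewrite ger0_norm ?(ltW (lam0 i x)) //.
  have := ler_enormD x (conj_rv (param_vec d i)).
  rewrite enorm_conj_rv (enorm_param_vec hd).
  rewrite mulrC ler_pdivrMr // mul1r; have := d2 i.1; nra.
- by rewrite invr_gt0 ltr0n /= invf_lt1 ?ltr1n ?ltr0n.
- move=> i x _; rewrite /lamF lef_pV2 ?posrE ?ltr0n //; have := d2 i.1; nra.
- by move=> i x y _ _; apply: Fsys_dist.
- by move=> i x y _ _; rewrite mul0r expR0 mulr1.
- by move=> i x _; apply: differentiable_Fsys.
- move=> i x v _; apply: conformal_of_dist.
  + exact: differentiable_Fsys.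
  + exact: (@cst_continuous _ _ (lamF i x) x).
  + exact/ltW/lam0.
  + by apply: (@filterE _ (nbhs x)) => y; apply: Fsys_dist.
Qed.

(** Strictness of 2 < d 0 makes the ratio (d 0 - 1)^-2 less than 1. The distortion exponent 2 comes
    from |y + a| <= |x + a| (1 + |x - y|), valid since |x + a| >= 1, by squaring and 1 + r <= exp
    r. *)
Lemma Gsys_mobius : compact (closed_disc R) -> 2 < d 0 ->
  mobius_system (closed_disc R) (Gsys d (T := T)) lamG ((d 0 - 1) ^+ 2)^-1 2 2.
Proof.
move=> comp d0.
have d0n n : d 0 <= d n.
  by have := admissible_ge hd (leq0n n); have : (0 : R) <= (n - 0)%:R by []; lra.
have N_gt1 i x : closed_disc R x -> 1 <= dotp (x + param_vec d i) (x + param_vec d i).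
  by move=> /(dotp_shift hd i)/andP[+ _]; have := d2 i.1; nra.
have N_neq0 i x : closed_disc R x -> dotp (x + param_vec d i) (x + param_vec d i) != 0.
  by move=> /(N_gt1 i) /lt_le_trans H; rewrite gt_eqF // H.
have lam0 i x : closed_disc R x -> 0 < lamG i x.
  by move=> /(N_gt1 i) /lt_le_trans H; rewrite invr_gt0 H.
split => //.
- by exists 0; apply: closed_disc0.
- exact: closed_disc_diam.
- move=> i x Xx; apply/closed_discE; rewrite GsysE dotpZl dotpC dotpZl dotp_conj_rv.
  by rewrite mulVf ?N_neq0 // mulr1 invf_le1 ?N_gt1 // (lt_le_trans ltr01) ?N_gt1.
- have d1 : 0 < d 0 - 1 by lra.
  by rewrite invr_gt0 exprn_gt0 //= invf_lt1 ?exprn_gt0 //; nra.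
- move=> i x Xx; rewrite /lamG lef_pV2 ?posrE.
  + have /andP[+ _] := dotp_shift hd i Xx; apply: le_trans.
    by rewrite ler_pXn2r ?nnegrE ?lerD2r ?d0n //; have := d2 i.1; lra.
  + by apply: lt_le_trans (N_gt1 i x Xx).
  + by rewrite exprn_gt0 //; lra.
- by move=> i x y Xx Xy; apply: Gsys_dist; apply: N_neq0.
- move=> i x y Xx Xy; rewrite /lamG -!sqr_enorm.
  have nx : 1 <= enorm (x + param_vec d i).
    by have /andP[+ _] := enorm_shift hd i Xx; have := d2 i.1; lra.
  have ny : 1 <= enorm (y + param_vec d i).
    by have /andP[+ _] := enorm_shift hd i Xy; have := d2 i.1; lra.
  have tr : enorm (y + param_vec d i) <= enorm (x + param_vec d i) + enorm (x - y).
    rewrite [enorm (x - y)]enormC; apply: le_trans (ler_enormD _ _).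
    by rewrite [X in _ <= enorm X]addrC addrA subrK.
  have ex : (1 + enorm (x - y)) ^+ 2 <= expR (2 * enorm (x - y)).
    rewrite mulrC expRM powR_mulrn ?expR_ge0 //.
    by rewrite ler_pXn2r ?nnegrE ?expR_ge0 ?expR_ge1Dx // addr_ge0 ?enorm_ge0.
  have xy := enorm_ge0 (x - y).
  rewrite ler_pdivlMl ?exprn_gt0 ?(lt_le_trans ltr01) //.
  rewrite ler_pdivrMr ?exprn_gt0 ?(lt_le_trans ltr01) //.
  apply: le_trans (ler_wpM2r (sqr_ge0 _) ex); rewrite -exprMn.
  by rewrite ler_pXn2r ?nnegrE ?enorm_ge0 //; nra.
- by move=> i x Xx; apply: differentiable_Gsys; apply: N_neq0.
- move=> i x v Xx; apply: conformal_of_dist.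
  + exact/differentiable_Gsys/N_neq0.
  + exact/differentiable_continuous/differentiable_lamG/N_neq0.
  + exact/ltW/lam0.
  + have : \forall y \near x, dotp (y + param_vec d i) (y + param_vec d i) != 0.
      have := differentiable_continuous (differentiable_shift (param_vec d i) x).
      by move=> /cvgr_neq0; apply; apply: N_neq0.
    by apply: filterS => y y0; apply: Gsys_dist => //; apply: N_neq0.
Qed.

End Systems.

(** The infimum absorbs the strict gap between r and t. *)
Lemma hausdorff_dim_le (R : realType) (n m : nat) (A : set 'rV[R]_n) (B : set 'rV[R]_m) :
  (forall r t : R, 0 <= r -> r < t -> hausdorff_measure r B = 0%E ->
     hausdorff_measure t A = 0%E) ->
  (hausdorff_dim A <= hausdorff_dim B)%E.
Proof.
move=> AB; apply: le_ereal_inf_tmp => _ [r [r0 Br] <-].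
apply/lee_addgt0Pr => e e0; apply: ereal_inf_lbound.
exists (r + e) => //; split; first by rewrite addr_ge0 // ltW.
by apply: AB r0 _ Br; rewrite ltrDl.
Qed.

(** * Bounds shared by the two systems *)

Section Bounds.
Variables (R : realType) (d : nat -> R) (T : nat).
Hypothesis hd : admissible d.
Implicit Types (i : nat * 'I_T) (x : 'rV[R]_2).

Let d2 n : 2 <= d n := d_ge2 hd n.

Lemma lamF_bounds i x :
  (d i.1 ^+ 2)^-1 / 4 <= lamF d i x <= 4 * (d i.1 ^+ 2)^-1.
Proof.
have := d2 i.1; rewrite /lamF; move: (d i.1) => D D2.
have D0 : 0 < D by lra.
have Dp : 0 < D ^+ 2 by nra.
have Dp1 : 0 < D ^+ 2 - 1 by nra.
rewrite -invfM -[4 in X in _ && X]invrK -invfM !lef_pV2 ?posrE ?mulr_gt0 ?invr_gt0 //.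
by apply/andP; split; nra.
Qed.

(** The constant 4 is the square of the 2 in D/2 <= D - 1 and D + 1 <= 2 D, both valid for D >=
    2. *)
Lemma lamG_bounds i x : closed_disc R x ->
  (d i.1 ^+ 2)^-1 / 4 <= lamG d i x <= 4 * (d i.1 ^+ 2)^-1.
Proof.
move=> /(dotp_shift hd i); have := d2 i.1; rewrite /lamG.
move: (dotp _ _) (d i.1) => N D D2 /andP[lo hi].
have D0 : 0 < D by lra.
have Dp : 0 < D ^+ 2 by nra.
have Np : 0 < N by apply: lt_le_trans lo; nra.
rewrite -invfM -[4 in X in _ && X]invrK -invfM !lef_pV2 ?posrE ?mulr_gt0 ?invr_gt0 //.
by apply/andP; split; nra.
Qed.

Hypothesis T0 : (0 < T)%N.

Lemma param_vec_real n : param_vec d (n, Ordinal T0) 0 0 = d n /\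
  param_vec d (n, Ordinal T0) 0 1 = 0.
Proof.
have [-> ->] := param_vecE d (n, Ordinal T0).
by rewrite /= mul0r mulr0 cos0 sin0 mul1r mul0r.
Qed.

Lemma Fsys_coord n x : closed_disc R x ->
  (d n + 1)^-1 <= Fsys d (n, Ordinal T0) x 0 0 <= (d n - 1)^-1.
Proof.
move=> /closed_discE; rewrite dotp2 (FsysE hd).
have [c0 _] := param_vec_real n.
have -> : ((d n ^+ 2 - 1)^-1 *: (x + conj_rv (param_vec d (n, Ordinal T0)))) 0 0 =
    (d n ^+ 2 - 1)^-1 * (x 0 0 + d n).
  by rewrite [LHS]mxE [(x + _)%R 0 0]mxE [conj_rv _ 0 0]mxE /= c0.
have := d2 n; move: (d n) (x 0 0) (x 0 1) => D p q D2 pq.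
have Dp1 : 0 < D ^+ 2 - 1 by nra.
have D1 : 0 < D - 1 by lra.
have D1' : 0 < D + 1 by lra.
have -> : D ^+ 2 - 1 = (D - 1) * (D + 1) by ring.
rewrite mulrC ler_pdivlMr ?mulr_gt0 // ler_pdivrMr ?mulr_gt0 //.
rewrite mulrCA mulVf ?gt_eqF // mulr1 mulrA mulVf ?gt_eqF // mul1r.
by apply/andP; split; nra.
Qed.

(** With x = (p, q) and D = d n, the lower bound reduces to q^2 <= (p + D)(1 - p), which follows
    from q^2 <= (1 + p)(1 - p); the upper one to D - 1 <= p + D. *)
Lemma Gsys_coord n x : closed_disc R x ->
  (d n + 1)^-1 <= Gsys d (n, Ordinal T0) x 0 0 <= (d n - 1)^-1.
Proof.
move=> /closed_discE; rewrite dotp2 GsysE.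
have [c0 c1] := param_vec_real n.
set c := param_vec _ _ in c0 c1 *.
have -> : ((dotp (x + c) (x + c))^-1 *: conj_rv (x + c)) 0 0 =
    ((x 0 0 + d n) ^+ 2 + x 0 1 ^+ 2)^-1 * (x 0 0 + d n).
  have e0 : (x + c) 0 0 = x 0 0 + d n by rewrite mxE c0.
  have e1 : (x + c) 0 1 = x 0 1 by rewrite mxE c1 addr0.
  by rewrite dotp2 e0 e1 -!expr2 [LHS]mxE [conj_rv _ 0 0]mxE /= e0.
have := d2 n; move: (d n) (x 0 0) (x 0 1) => D p q D2 pq.
have D1 : 0 < D - 1 by lra.
have D1' : 0 < D + 1 by lra.
have p1 : p <= 1 by nra.
have p2 : -1 <= p by nra.
have Np : 0 < (p + D) ^+ 2 + q ^+ 2 by nra.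
rewrite mulrC ler_pdivlMr // ler_pdivrMr //.
rewrite ler_pdivrMl // ler_pdivlMl //.
by apply/andP; split; nra.
Qed.

End Bounds.

(* If d_0 = 2 then g_2 has derivative of norm 1 at -1. *)
Lemma Gsys_contracts_gt2 (R : realType) (d : nat -> R) (T : nat) :
  admissible d -> (0 < T)%N -> is_ifs (closed_disc R) (Gsys d (T := T)) -> 2 < d 0.
Proof.
move=> hd T0 [_ _ _ _ lip1]; rewrite lt_neqAle; apply/andP; split; last by case: hd.
apply/negP => /eqP d02.
pose i : nat * 'I_T := (0%N, Ordinal T0).
have [c0 c1] := param_vec_real d T0 0.
rewrite -/i -d02 in c0 c1.
pose pt (a : R) : 'rV[R]_2 := a *: delta_mx 0 0.
have pt0 a : pt a 0 0 = a by rewrite !mxE /= mulr1.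
have pt1 a : pt a 0 1 = 0 by rewrite !mxE /= mulr0.
have dpt a : dotp (pt a) (pt a) = a ^+ 2 by rewrite dotp2 pt0 pt1; ring.
have lamE a : lamG d i (pt a) = ((a + 2) ^+ 2)^-1.
  have e0 : (pt a + param_vec d i) 0 0 = a + 2 by rewrite mxE pt0 c0.
  have e1 : (pt a + param_vec d i) 0 1 = 0 by rewrite mxE pt1 c1 addr0.
  by rewrite /lamG dotp2 e0 e1 mulr0 addr0 expr2.
set L := ereal_sup _ in lip1.
(* The difference quotient between -1 and -1 + e is exactly 1/(1+e), as z + 2 takes there the values
   1 and 1 + e; e <= 1 keeps both points in the disc. *)
have ratio e : 0 < e -> e <= 1 -> (((1 + e)^-1)%:E <= L)%E.
  move=> e0 e1.
  have Xa a : -1 <= a <= 0 -> closed_disc R (pt a).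
    by move=> ?; apply/closed_discE; rewrite dpt; nra.
  have X1 : closed_disc R (pt (-1)) by apply: Xa; lra.
  have X2 : closed_disc R (pt (-1 + e)) by apply: Xa; lra.
  have N0 a : -1 <= a -> dotp (pt a + param_vec d i) (pt a + param_vec d i) != 0.
    move=> a1; rewrite -invr_eq0 -[X in X != 0]/(lamG d i (pt a)) lamE.
    by rewrite invr_eq0 gt_eqF // exprn_gt0 //; lra.
  apply: (@le_trans _ _ (Lip (closed_disc R) (Gsys d i))); last first.
    by apply: ereal_sup_ubound; exists i.
  apply: ereal_sup_ubound; exists (pt (-1 + e), pt (-1)) => /=.
    split=> // /(congr1 (fun v : 'rV[R]_2 => v 0 0)); rewrite !pt0; lra.
  congr EFin.
  have ptB : pt (-1 + e) - pt (-1) = pt e.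
    by rewrite /pt -scalerBl; congr (_ *: _); ring.
  have ne : enorm (pt e) = e by rewrite /enorm dpt sqrtr_sqr ger0_norm // ltW.
  rewrite {1}/enorm Gsys_dist ?N0 //; [|lra..].
  rewrite ptB ne dpt !lamE.
  have [-> ->] : (-1 + e + 2 = 1 + e) * (-1 + 2 = 1 :> R) by split; ring.
  have p0 : 1 + e != 0 by rewrite gt_eqF //; lra.
  have -> : e ^+ 2 * (((1 + e) ^+ 2)^-1 * (1 ^+ 2)^-1) = (e / (1 + e)) ^+ 2 by field.
  rewrite sqrtr_sqr ger0_norm; last by rewrite divr_ge0 //; lra.
  by field; rewrite p0 gt_eqF.
have r1 := ratio 1 ltr01 (lexx _).
have Lfin : L \is a fin_num.
  rewrite fin_numElt (lt_le_trans _ r1) ?ltNyr //=; exact: lt_trans lip1 (ltry _).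
have LE := fineK Lfin; rewrite -LE in lip1 r1 ratio.
set l := fine L in lip1 r1 ratio.
rewrite lte_fin in lip1; rewrite lee_fin in r1.
have l0 : 0 < l by apply: lt_le_trans r1; rewrite invr_gt0; lra.
(* With x = 1 - l > 0 one has (1 - x)(1 + x/2) < 1, so the quotient at e = x/2 exceeds [l]. *)
have := ratio ((1 - l) / 2); rewrite lee_fin => H.
have {}H : (1 + (1 - l) / 2)^-1 <= l by apply: H; lra.
have p0 : 0 < 1 + (1 - l) / 2 by lra.
by move: H; rewrite -[leLHS]mul1r ler_pdivrMr //; nra.
Qed.

Theorem theorem4 (R : realType) (d : nat -> R) (T : nat)
    (hd : admissible d) (hT : (0 < T)%N)
    (hF : is_cifs (closed_disc R) (Fsys d (T := T)))
    (hG : is_cifs (closed_disc R) (Gsys d (T := T))) :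
  (irregular (closed_disc R) (Fsys d (T := T)) ->
     (hausdorff_dim (limit_set (closed_disc R) (Fsys d (T := T))) <=
      hausdorff_dim (limit_set (closed_disc R) (Gsys d (T := T))))%E) /\
  (irregular (closed_disc R) (Gsys d (T := T)) ->
     (hausdorff_dim (limit_set (closed_disc R) (Gsys d (T := T))) <=
      hausdorff_dim (limit_set (closed_disc R) (Fsys d (T := T))))%E).
Proof.
have [[[comp _] _ _ _ _] _ _ _] := hF; have [ifsG _ _ _] := hG.
have mF := Fsys_mobius T hd comp.
have mG := Gsys_mobius T hd comp (Gsys_contracts_gt2 hd hT ifsG).
have lF (i : nat * 'I_T) x (_ : closed_disc R x) := lamF_bounds hd i x.
have lG := @lamG_bounds R d T hd.
have cF := @Fsys_coord R d T hd hT.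
have cG := @Gsys_coord R d T hd hT.
split=> irr; apply: hausdorff_dim_le => r t r0 rt H.
(* [B] mentions only [d], so it passes from one system to the other. *)
- have B := hausdorff_eq0_even_sum hd mG lG cG r0 H.
  exact: (hausdorff_eq0_irregular hd mF lF r0 rt B irr).
- have B := hausdorff_eq0_even_sum hd mF lF cF r0 H.
  exact: (hausdorff_eq0_irregular hd mG lG r0 rt B irr).
Qed.
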